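(* Let $d\ge2$ and let $\varphi^\varepsilon$, $\lambda^\varepsilon$, $\omega$, $D_1$ be as in the context. There exist $c_1=c_1(\omega,D_1)>0$ and $\epsilon_1=\epsilon_1(\omega)>0$ such that for every $T>0$ $$\sup_{\varepsilon\in(0,\epsilon_1)}\int_0^T|\lambda^\varepsilon(t)|^2\,dt\le c_1(1+T).$$
   Context: Basic notation. $\Omega=\mathbb{T}^d=(\mathbb{R}/\mathbb{Z})^d$, also identified with $[0,1)^d\subset\mathbb{R}^d$; functions, sets and measures on $\Omega$ are extended $\Omega$-periodically to $\mathbb{R}^d$. $W(s)=\frac{(1-s^2)^2}{2}$, $k(s)=\int_0^s\sqrt{2W(\tau)}\,d\tau$ (equal to $s-\frac13s^3$ for $|s|\le1$), $\sigma=\int_{-1}^1\sqrt{2W(s)}\,ds$, $q^\varepsilon(r)=\tanh(r/\varepsilon)$. $B_R(x)$ is the open ball, $\omega_{d-1}$ the volume of the unit ball of $\mathbb{R}^{d-1}$; $\|\nabla\chi_A\|$ is the total variation measure of the distributional gradient of $\chi_A$. Initial set. $U_0\subset\subset(0,1)^d$ is a bounded open set, $M_0=\partial U_0$, such that: (1) there is $D_0>0$ with $\sup_{x\in\mathbb{R}^d,R>0}\frac{\mathcal{H}^{d-1}(M_0\cap B_R(x))}{\omega_{d-1}R^{d-1}}\le D_0$; (2) there are open sets $U_0^i\subset(0,1)^d$, $i\ge1$, with $C^3$ boundaries $M_0^i$, such that $\mathcal{L}^d(U_0\triangle U_0^i)\to0$ and $\|\nabla\chi_{U_0^i}\|\to\|\nabla\chi_{U_0}\|$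 as measures. $U_0^i$, $M_0^i$ are extended periodically to $\mathbb{R}^d$. Initial data. Let $\varepsilon_i\in(0,1)$, $\varepsilon_i\downarrow0$. Let $r_{\varepsilon_i}(x)=\mathrm{dist}(x,M_0^i)$ for $x\in U_0^i$ and $-\mathrm{dist}(x,M_0^i)$ for $x\notin U_0^i$; let $\overline{r_{\varepsilon_i}}$ be a periodic smoothing of $r_{\varepsilon_i}$ with $|\nabla\overline{r_{\varepsilon_i}}|\le1$, $|\nabla^2\overline{r_{\varepsilon_i}}|\le\varepsilon_i^{-1}$ on $\mathbb{R}^d$ and $\overline{r_{\varepsilon_i}}=r_{\varepsilon_i}$ near $M_0^i$. Put $\varphi_0^{\varepsilon_i}=q^{\varepsilon_i}(\overline{r_{\varepsilon_i}})$. Throughout, $\varepsilon$ stands for elements $\varepsilon_i$ of this sequence (so $\varepsilon\in(0,\epsilon_1)$ means those $\varepsilon_i<\epsilon_1$). Equation. $\varphi^\varepsilon$ is the (periodic, global in time) solution of $$\varepsilon\varphi_t^\varepsilon=\varepsilon\Delta\varphi^\varepsilon-\frac{W'(\varphi^\varepsilon)}{\varepsilon}+\lambda^\varepsilon\sqrt{2W(\varphi^\varepsilon)}\ \text{ in }\Omega\times(0,\infty),\qquad\varphi^\varepsilon(\cdot,0)=\varphi_0^\varepsilon,$$ $$\lambda^\varepsilon(t)=\frac{-\int_\Omega\sqrt{2W(\varphi^\varepsilon)}\,\big(\varepsilon\Delta\varphi^\varepsilon-W'(\varphi^\varepsilon)/\varepsilon\big)\,dx}{2\int_\Omega W(\varphi^\varepsilon)\,dx}.$$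 Measures and constants. $\mu_t^\varepsilon(\phi)=\frac1\sigma\int_{\mathbb{R}^d}\phi\big(\frac{\varepsilon|\nabla\varphi^\varepsilon|^2}{2}+\frac{W(\varphi^\varepsilon)}{\varepsilon}\big)dx$ for $\phi\in C_c(\mathbb{R}^d)$. Standing properties of the initial data: $\omega=\omega(U_0)>0$ and $D_1=D_1(D_0)>0$ are constants such that, for all $\varepsilon=\varepsilon_i$, $|\int_\Omega k(\varphi_0^\varepsilon)\,dx|\le\frac23-\omega$, $\mu_0^\varepsilon(\Omega)\le D_1$, and $\mu_0^\varepsilon(B_R(x))\le D_1\omega_{d-1}R^{d-1}$ for all $x\in\mathbb{R}^d$, $0<R\le1$. *)

(* Defs.v *)
From HB Require Import structures.
From mathcomp Require Import all_boot all_order all_algebra.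
From mathcomp Require Import all_classical all_reals all_analysis.
From mathcomp Require Import measurable_realfun.

Set Implicit Arguments.
Unset Strict Implicit.
Unset Printing Implicit Defensive.
Import Order.TTheory GRing.Theory Num.Theory.
Import numFieldNormedType.Exports.
Local Open Scope classical_set_scope.
Local Open Scope ring_scope.

Definition borelRn (R : realType) (n : nat) :=
  g_sigma_algebraType (@open 'rV[R]_n).
(* Lebesgue measure on the Borel sets of R^n, by induction on n: the image of
   the product of the Lebesgue measures of R and R^n by the bijection [consRn]
   from R * R^n onto R^n.+1. *)
Section lebesgueRn.
Context {R : realType}.

Definition consRn (n : nat) (p : measurableTypeR R * borelRn R n) :
    borelRn R n.+1 :=
  \row_(i < n.+1) oapp (fun j => (p.2 : 'rV[R]_n) 0 j) p.1 (unlift ord0 i).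

Definition unconsRn (n : nat) (x : borelRn R n.+1) :
    measurableTypeR R * borelRn R n :=
  ((x : 'rV_n.+1) 0 0, \row_j (x : 'rV_n.+1) 0 (lift ord0 j)).

Lemma consRnK n : cancel (@consRn n) (@unconsRn n).
Proof.
case=> t y; rewrite /unconsRn /consRn /= mxE unlift_none/=; congr pair.
by apply/rowP => j; rewrite !mxE liftK.
Qed.

Lemma measurable_consRn n : measurable_fun setT (@consRn n).
Proof.
apply: (@measurability _ _ _ (borelRn R n.+1) _ _ (@open 'rV[R]_n.+1) erefl) => // _ [V oV <-].
rewrite setTI; set W := _ @^-1` _.
pose box (c : rat * 'rV[rat]_n * nat) : set (measurableTypeR R * borelRn R n) :=
  ball (ratr c.1.1 : R) (c.2.+1%:R^-1) `*`
  ball (map_mx ratr c.1.2 : 'rV[R]_n) (c.2.+1%:R^-1).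
have mbox c : measurable (box c).
  apply: measurableX; first by apply: open_measurable; exact: ball_open.
  by apply: sub_sigma_algebra; exact: ball_open.
pose F c := if `[< box c `<=` W >] then box c else set0.
rewrite (_ : W = \bigcup_c F c); last first.
  apply/seteqP; split => [[t y] Wp|p [c _]]; last first.
    by rewrite /F; case: asboolP => // + /[dup] => /[apply].
  have /nbhs_ballP[e /= e0 eV] : nbhs (consRn (t, y) : 'rV[R]_n.+1) V.
    by apply: open_nbhs_nbhs; split.
  have [k ke] : exists k : nat, k.+1%:R^-1 + k.+1%:R^-1 < e.
    exists (Num.truncn (2 / e)); set k := Num.truncn _.
    rewrite -mulr2n -[ltLHS]mulr_natl ltr_pdivrMr ?ltr0n// -ltr_pdivrMl//.
    by rewrite mulrC; exact: truncnS_gt.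
  have k0 : 0 < k.+1%:R^-1 :> R by rewrite invr_gt0 ltr0n.
  have rat_near (s : R) : exists q : rat, `|ratr q - s| < k.+1%:R^-1.
    have [|q] := @rat_in_itvoo R (s - k.+1%:R^-1) (s + k.+1%:R^-1).
      by rewrite ltrD2l (lt_trans _ k0)// oppr_lt0.
    rewrite in_itv/= => /andP[q1 q2]; exists q.
    by rewrite ltr_distl q1 q2.
  have [q qt] := rat_near t.
  have /choice[v vy] : forall j, exists q : rat,
      `|ratr q - (y : 'rV[R]_n) 0 j| < k.+1%:R^-1.
    by move=> j; exact: rat_near.
  exists (q, \row_j v j, k) => //.
  have boxp : box (q, \row_j v j, k) (t, y).
    by split => //=; split => // i j; rewrite !mxE ord1; exact: vy.
  rewrite /F asboolT// => -[t' y'] [/= qt' [_ vy']]; apply: eV.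
  apply: le_ball (ltW ke) _ _; split; first exact: addr_gt0.
  move=> i j; rewrite !mxE; case: unliftP => [j' _|_]/=; last first.
    by apply: ball_triangle (ball_sym _) qt'; exact: qt.
  have vR : ball (ratr (v j') : R) k.+1%:R^-1 ((y : 'rV[R]_n) 0 j') by exact: vy.
  apply: ball_triangle (ball_sym vR) _.

  by have := vy' 0 j'; rewrite !mxE.
apply: countable_bigcupT_measurable => [|c]; first exact: countableP.
by rewrite /F; case: asboolP.
Qed.

Lemma measurable_unconsRn n : measurable_fun setT (@unconsRn n).
Proof.
apply: measurable_fun_pair.
  apply: (measurability _ (RGenOpens.measurableE R)).
  move=> _ [_ [a [b ->] <-]]; rewrite setTI; apply: sub_sigma_algebra.
  have /continuousP := @coord_continuous R 1 n.+1 0 0; apply.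
  exact: interval_open.
apply: (@measurability _ _ _ (borelRn R n) _ _ (@open 'rV[R]_n) erefl) => // _ [V oV <-].
rewrite setTI; apply: sub_sigma_algebra.
rewrite /= openE => x /= Vx.
have /nbhs_ballP[e /= e0 eV] : nbhs (\row_j (x : 'rV[R]_n.+1) 0 (lift ord0 j)) V.
  by apply: open_nbhs_nbhs; split.
apply/nbhs_ballP; exists e => //= z [_ xz]; apply: eV; split => // i j.
by rewrite !mxE; exact: xz.
Qed.

Section step.
Context (n : nat) (m : {sigma_finite_measure set (borelRn R n) -> \bar R}).

Definition lebesgueRn_step : set (borelRn R n.+1) -> \bar R :=
  pushforward (lebesgue_measure \x m)%E (@consRn n).

Let lebesgueRn_step0 : lebesgueRn_step set0 = 0%E.
Proof. by rewrite /lebesgueRn_step /pushforward preimage_set0 measure0. Qed.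

Let lebesgueRn_step_ge0 A : (0 <= lebesgueRn_step A)%E.
Proof. exact: (measure_ge0 (lebesgue_measure \x m)%E). Qed.

Let lebesgueRn_step_sigma_additive : semi_sigma_additive lebesgueRn_step.
Proof.
have mcons A : measurable A -> measurable (@consRn n @^-1` A).
  by move=> mA; rewrite -[X in measurable X]setTI; exact: measurable_consRn.
move=> F mF tF mUF; rewrite /lebesgueRn_step /pushforward preimage_bigcup.
apply: (@measure_semi_sigma_additive _ _ _ (lebesgue_measure \x m)%E).
- by move=> i; exact: mcons.
- apply/trivIsetP => /= i j _ _ ij; rewrite -preimage_setI.
  by move/trivIsetP : tF => /(_ _ _ _ _ ij) ->//; rewrite preimage_set0.
- by rewrite -preimage_bigcup; exact: mcons.
Qed.

HB.instance Definition _ := isMeasure.Build _ _ _ lebesgueRn_step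
  lebesgueRn_step0 lebesgueRn_step_ge0 lebesgueRn_step_sigma_additive.

Let lebesgueRn_step_sigma_finite : sigma_finite setT lebesgueRn_step.
Proof.
have /sigma_finiteP[F [TF ndF Foo]] := sigma_finiteT (@lebesgue_measure R).
have /sigma_finiteP[G [TG ndG Goo]] := sigma_finiteT m.
exists (fun k => @unconsRn n @^-1` (F k `*` G k)).
  apply/seteqP; split=> // x _.
  have [i _ Fi] : (\bigcup_i F i) (unconsRn x).1 by rewrite -TF.
  have [j _ Gj] : (\bigcup_i G i) (unconsRn x).2 by rewrite -TG.
  exists (maxn i j) => //; split.
    by move: Fi; exact/subsetPset/ndF/leq_maxl.
  by move: Gj; exact/subsetPset/ndG/leq_maxr.
move=> k; have [mF Fk] := Foo k; have [mG Gk] := Goo k; split.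
  rewrite -[X in measurable X]setTI; apply: measurable_unconsRn => //.
  exact: measurableX.
rewrite /lebesgueRn_step /pushforward -comp_preimage.
rewrite (_ : _ \o _ = idfun); last by apply/funext => p; exact: consRnK.
by rewrite preimage_id product_measure1E// lte_mul_pinfty// ge0_fin_numE.
Qed.

HB.instance Definition _ := Measure_isSigmaFinite.Build _ _ _ lebesgueRn_step
  lebesgueRn_step_sigma_finite.

End step.

Fixpoint lebesgueRn n : {sigma_finite_measure set (borelRn R n) -> \bar R} :=
  if n is n'.+1 return {sigma_finite_measure set (borelRn R n) -> \bar R}
  then lebesgueRn_step (lebesgueRn n')
  else @dirac _ (borelRn R 0) (0 : 'rV[R]_0) R.

End lebesgueRn.

Section euclidean_calculus.
Context {R : realType} {d : nat}.
Local Notation Rd := 'rV[R]_d.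
Implicit Types (x : Rd) (A V M : set Rd) (f u : Rd -> R).

(* The norm of the library on row vectors is the sup norm. *)
Definition enorm n (x : 'rV[R]_n) : R := Num.sqrt (\sum_i x 0 i ^+ 2).

Definition eball n (x : 'rV[R]_n) (r : R) : set 'rV[R]_n :=
  [set y | enorm (y - x) < r].

Definition unit_ball_volume (n : nat) : R :=
  fine (lebesgueRn n (eball (0 : 'rV[R]_n) 1)).

Definition partial (i : 'I_d) f : Rd -> R := 'D_(delta_mx 0 i) f.

Definition grad f x : Rd := \row_i partial i f x.

Definition hessian f x : 'M[R]_d := \matrix_(i, j) partial i (partial j f) x.

Definition laplacian f x : R := \sum_i partial i (partial i f) x.

Definition divergence (g : Rd -> Rd) x : R :=
  \sum_i partial i (fun y => g y 0 i) x.

Definition frobenius_norm (H : 'M[R]_d) : R :=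
  Num.sqrt (\sum_i \sum_j H i j ^+ 2).

(* Class C^k on an open set V. *)
Fixpoint class_C (k : nat) V f : Prop :=
  (forall x, V x -> {for x, continuous f}) /\
  (if k is k'.+1 then
     forall i, (forall x, V x -> derivable f x (delta_mx 0 i)) /\
               class_C k' V (partial i f)
   else True).

Definition boundary A : set Rd := closure A `\` interior A.

Definition C3_boundary A : Prop :=
  forall p, boundary A p -> exists (V : set Rd) (g : Rd -> R),
    [/\ open V, V p, class_C 3 V g,
        forall x, V x -> grad g x != 0 &
        forall x, V x -> (A x <-> 0 < g x)].

Definition supported_in V (T : nmodType) (g : Rd -> T) : Prop :=
  exists K : set Rd, [/\ compact K, K `<=` V & forall x, ~ K x -> g x = 0].

(* The unit cube [0,1)^d represents the torus. *)
Definition cube : set Rd := [set x | forall i, 0 <= x 0 i < 1].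

Definition open_cube : set Rd := [set x | forall i, 0 < x 0 i < 1].

Definition periodic f : Prop :=
  forall x (z : 'rV[int]_d), f (x + map_mx intr z) = f x.

Definition periodic_extension A : set Rd :=
  [set x | exists z : 'rV[int]_d, A (x + map_mx intr z)].

Definition dist x M : R := inf [set enorm (x - y) | y in M].

Definition signed_dist A M x : R :=
  if x \in A then dist x M else - dist x M.

End euclidean_calculus.

Section geometric_measures.
Context {R : realType} {d : nat}.
Local Notation Rd := 'rV[R]_d.
Implicit Types A B V : set Rd.

Definition diam A : R := sup [set enorm (p.1 - p.2) | p in A `*` A].

Definition hausdorff_content (s : nat) (delta : R) A : \bar R :=
  ereal_inf [set (\sum_(0 <= k <oo)
      (unit_ball_volume s * (diam (C k) / 2) ^+ s)%:E)%E | C in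
    [set C : (set Rd)^nat | A `<=` \bigcup_k C k /\
      forall k x y, C k x -> C k y -> enorm (x - y) <= delta]].

(* The s-dimensional Hausdorff measure, for an integer s >= 1. *)
Definition hausdorff_measure (s : nat) A : \bar R :=
  ereal_sup [set hausdorff_content s delta A | delta in [set e : R | 0 < e]].

(* Total variation of the distributional gradient of the characteristic
   function of A: on open sets by duality with C^1 vector fields compactly
   supported in V, then on all sets by outer regularity. On Borel sets it is a
   measure when A has locally finite perimeter. *)
Definition variation_on_open A V : \bar R :=
  ereal_sup [set (\int[lebesgueRn d]_(x in A) divergence g x)%:E | g in
    [set g : Rd -> Rd |
      [/\ forall i, class_C 1 setT (fun x => g x 0 i),
          supported_in V g & forall x, enorm (g x) <= 1]]].

Definition perimeter_measure A : set (borelRn R d) -> \bar R :=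
  fun B => ereal_inf [set variation_on_open A V | V in
    [set V : set Rd | open V /\ B `<=` V]].

Record initial_set (U0 : set Rd) (U : (set Rd)^nat) : Prop := {
  initial_open : open U0;
  initial_sub : closure U0 `<=` open_cube;
  initial_density : exists2 D0 : R, 0 < D0 &
    forall (x : Rd) (r : R), 0 < r ->
      (hausdorff_measure d.-1 (boundary U0 `&` eball x r) <=
       (D0 * (unit_ball_volume d.-1 * r ^+ d.-1))%:E)%E;
  approx_open : forall i, open (U i);
  approx_sub : forall i, U i `<=` open_cube;
  approx_C3 : forall i, C3_boundary (U i);
  approx_volume :
    lebesgueRn d ((U0 `\` U i) `|` (U i `\` U0)) @[i --> \oo] --> 0%E;
  approx_perimeter : forall f : Rd -> R,
    continuous f -> supported_in setT f ->
    (\int[perimeter_measure (U i)]_x (f x)%:E)%E @[i --> \oo] -->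
      (\int[perimeter_measure U0]_x (f x)%:E)%E }.

End geometric_measures.

Section phase_field.
Context {R : realType} {d : nat}.
Local Notation Rd := 'rV[R]_d.
Implicit Types (eps t : R) (u : Rd -> R).

Definition W (s : R) : R := (1 - s ^+ 2) ^+ 2 / 2.

(* The integral from a to b, with the usual sign convention if b < a. *)
Definition oriented_integral (a b : R) (f : R -> R) : R :=
  if a <= b then \int[lebesgue_measure]_(s in `[a, b]) f s
  else - \int[lebesgue_measure]_(s in `[b, a]) f s.

Definition k (s : R) : R :=
  oriented_integral 0 s (fun r => Num.sqrt (2 * W r)).

Definition sigma : R := oriented_integral (- 1) 1 (fun r => Num.sqrt (2 * W r)).

Definition tanh (r : R) : R := (expR r - expR (- r)) / (expR r + expR (- r)).

Definition q eps (r : R) : R := tanh (r / eps).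

(* [M] is the interface and [A] the open set where the distance is positive. *)
Record smoothed_signed_dist eps (A M : set Rd) (r : Rd -> R) : Prop := {
  smoothed_periodic : periodic r;
  smoothed_C2 : class_C 2 setT r;
  smoothed_grad : forall x, enorm (grad r x) <= 1;
  smoothed_hessian : forall x, frobenius_norm (hessian r x) <= eps^-1;
  smoothed_near : exists V : set Rd,
    [/\ open V, M `<=` V & forall x, V x -> r x = signed_dist A M x] }.

Definition lambda eps u : R :=
  - (\int[lebesgueRn d]_(x in cube)
       (Num.sqrt (2 * W (u x)) *
        (eps * laplacian u x - derive1 W (u x) / eps))) /
  (2 * \int[lebesgueRn d]_(x in cube) W (u x)).

(* Global classical periodic solutions; the space derivatives up to order 2
   are continuous up to the initial time. *)
Record solution eps (u0 : Rd -> R) (phi : R -> Rd -> R) : Prop := {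
  solution_periodic : forall t, 0 <= t -> periodic (phi t);
  solution_C2 : forall t, 0 <= t -> class_C 2 setT (phi t);
  solution_continuous :
    {within [set p : R * Rd | 0 <= p.1], continuous (fun p => phi p.1 p.2)};
  solution_partial_continuous : forall i,
    {within [set p : R * Rd | 0 <= p.1],
      continuous (fun p => partial i (phi p.1) p.2)};
  solution_partial2_continuous : forall i j,
    {within [set p : R * Rd | 0 <= p.1],
      continuous (fun p => partial i (partial j (phi p.1)) p.2)};
  solution_derivable : forall t x, 0 < t -> derivable (phi ^~ x) t 1;
  solution_dt_continuous :
    {within [set p : R * Rd | 0 < p.1],
      continuous (fun p => derive1 (phi ^~ p.2) p.1)};
  solution_equation : forall t x, 0 < t ->
    eps * derive1 (phi ^~ x) t =
      eps * laplacian (phi t) x - derive1 W (phi t x) / eps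
      + lambda eps (phi t) * Num.sqrt (2 * W (phi t x));
  solution_initial : phi 0 = u0 }.

Definition energy_measure eps u (B : set Rd) : \bar R :=
  (sigma^-1%:E * \int[lebesgueRn d]_(x in B)
     (eps * enorm (grad u x) ^+ 2 / 2 + W (u x) / eps)%:E)%E.

Record initial_bounds (omega D1 eps : R) (u0 : Rd -> R) : Prop := {
  bound_volume :
    `|\int[lebesgueRn d]_(x in cube) k (u0 x)| <= 2 / 3 - omega;
  bound_energy : (energy_measure eps u0 cube <= D1%:E)%E;
  bound_density : forall (x : Rd) (r : R), 0 < r <= 1 ->
    (energy_measure eps u0 (eball x r) <=
     (D1 * (unit_ball_volume d.-1 * r ^+ d.-1))%:E)%E }.

End phase_field.

(* Main.v *)
Require Import Defs.
From mathcomp Require Import all_boot all_order all_algebra.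
From mathcomp Require Import all_classical all_reals all_analysis.
From mathcomp Require Import measurable_realfun ring lra.
Import Order.TTheory GRing.Theory Num.Theory.
Import numFieldNormedType.Exports.
Set Implicit Arguments.
Unset Strict Implicit.
Unset Printing Implicit Defensive.
Local Open Scope classical_set_scope.
Local Open Scope ring_scope.

(** Write E for the energy, S = avg |1 - phi^2| for the size of the transition
    layer and D for the dissipation, the average of eps phi_t^2.

    The multiplier lambda is chosen so that the volume, the average of k phi, is
    preserved ([is_derive_volume]). Testing the equation with phi_t then gives
    E' = - D ([is_derive_energy]). Hence E stays below its initial value, the modulus
    of the volume stays below 2/3 - omega, and D has integral at most E(0). It therefore suffices to prove, at each positive time,
    the bound lambda^2 <= A + B D with constants that depend only on the dimension,
    on omega and on the energy bound ([sqr_lambda_le]).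

    This bound is proved by a dichotomy. If S >= omega / 2, the energy bound forces
    eps to be bounded below, and the average of the equation over the torus
    determines lambda, the Laplacian having average 0 ([sqr_lambda_le_diffuse]).

    If S <= omega / 2, then |k phi| is close to 2/3 in mean, whereas the mean of
    k phi is at most 2/3 - omega in modulus; so k phi oscillates by omega / 2 in L1.
    Multiplying the equation by the gradient of phi gives
      lambda grad (k phi) = eps phi_t grad phi + div T,
    where T is the stress tensor, whose entries have L1 norm at most 3 E by
    [stress_le]. This is an estimate of lambda in a negative norm: after
    mollification at a small scale delta, the divergence costs a factor 1 / delta
    and the Poincare inequality bounds the left-hand side below by lambda times the
    oscillation of k phi, less an error of order delta E since the gradient of k phi
    is dominated by the energy density ([multiplier_bound], [grad_k_le_energy]). The
    usual argument tests with a vector field obtained from an elliptic equation;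
    mollifying the identity itself replaces elliptic regularity by the elementary
    [poincare]. Values of phi outside [-1, 1] are harmless, because
    |k s| >= 2/3 - |1 - s^2| for every real s ([k_ge]), so that no maximum principle
    enters.

    All the analysis is done with averages over the cube of continuous functions:
    their translation invariance ([avg_shift]), the divergence theorem
    ([avg_derive0]), the interchange of two averages ([avg_swap]) and the
    passage to the limit under uniform convergence on the compact cube
    ([avg_cvg]). *)

(** * Continuity of algebraic expressions *)
Section continuous_arithmetic.
Context {T : topologicalType} {R : realType}.
Implicit Types f g : T -> R.

Lemma eq_cont f g : f =1 g -> continuous f -> continuous g.
Proof. by move=> /funext ->. Qed.

Lemma cont_cst (S : topologicalType) (c : S) : continuous (fun _ : T => c).
Proof. by move=> x; exact: cvg_cst. Qed.

Lemma contD f g : continuous f -> continuous g -> continuous (fun x => f x + g x).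
Proof. by move=> cf cg x; exact: cvgD (cf x) (cg x). Qed.

Lemma contN f : continuous f -> continuous (fun x => - f x).
Proof. by move=> cf x; exact: cvgN (cf x). Qed.

Lemma contM f g : continuous f -> continuous g -> continuous (fun x => f x * g x).
Proof. by move=> cf cg x; exact: cvgM (cf x) (cg x). Qed.

Lemma contX f n : continuous f -> continuous (fun x => f x ^+ n).
Proof.
move=> cf; elim: n => [|n IH]; first exact: cont_cst.
by apply: (eq_cont (fun x => esym (exprS (f x) n))); exact: contM.
Qed.

Lemma cont_norm f : continuous f -> continuous (fun x => `|f x|).
Proof. by move=> cf x; exact: cvg_norm (cf x). Qed.

Lemma cont_sum (I : Type) (r : seq I) (P : pred I) (F : I -> T -> R) :
  (forall i, P i -> continuous (F i)) -> continuous (fun x => \sum_(i <- r | P i) F i x).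
Proof.
move=> cF; elim: r => [|i r IH].
  by apply: (eq_cont (fun x => esym (big_nil _ _ _ _))); exact: cont_cst.
apply: (eq_cont (fun x => esym (big_cons _ _ _ _ _ _))).
by have cFi := cF i; case: (P i) cFi => // cFi; apply: contD => //; exact: cFi.
Qed.

Lemma cont_prod (I : Type) (r : seq I) (P : pred I) (F : I -> T -> R) :
  (forall i, P i -> continuous (F i)) -> continuous (fun x => \prod_(i <- r | P i) F i x).
Proof.
move=> cF; elim: r => [|i r IH].
  by apply: (eq_cont (fun x => esym (big_nil _ _ _ _))); exact: cont_cst.
apply: (eq_cont (fun x => esym (big_cons _ _ _ _ _ _))).
by have cFi := cF i; case: (P i) cFi => // cFi; apply: contM => //; exact: cFi.
Qed.

End continuous_arithmetic.

Section continuous_composition.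
Context {S T U : topologicalType}.

Lemma cont_id : continuous (fun x : S => x).
Proof. by move=> x; exact: cvg_id. Qed.

Lemma cont_comp (f : S -> T) (g : T -> U) : continuous f -> continuous g ->
  continuous (fun x => g (f x)).
Proof. by move=> cf cg x; apply: (@continuous_comp _ _ _ f g); [exact: cf|exact: cg]. Qed.

Lemma cont_pair (f : S -> T) (g : S -> U) : continuous f -> continuous g ->
  continuous (fun x => (f x, g x)).
Proof. by move=> cf cg x; exact: (cvg_pair (cf x) (cg x)). Qed.

Lemma cont_fst : continuous (fun p : S * T => p.1).
Proof. by move=> p; exact: cvg_fst. Qed.

Lemma cont_snd : continuous (fun p : S * T => p.2).
Proof. by move=> p; exact: cvg_snd. Qed.

End continuous_composition.

Section continuous_vectors.
Context {T : topologicalType} {R : numFieldType} {V : normedModType R}.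

Lemma cont_addv (f g : T -> V) : continuous f -> continuous g ->
  continuous (fun x => f x + g x).
Proof. by move=> cf cg x; exact: cvgD (cf x) (cg x). Qed.

Lemma cont_scalev (f : T -> R) (g : T -> V) : continuous f -> continuous g ->
  continuous (fun x => f x *: g x).
Proof. by move=> cf cg x; exact: cvgZ (cf x) (cg x). Qed.

End continuous_vectors.

(** Decides continuity of an expression by its outermost operation; the cases
    are selected by syntax because unification alone is slow on the deep
    structures of normed spaces. *)
Ltac cont := try match goal with H : ?G |- ?G => exact: H end; lazymatch goal with
  | |- forall x, continuous_at x (fun y => (@?A y + @?B y)%R) =>
      (apply: (@contD _ _ A B) || apply: (@cont_addv _ _ _ A B)); cont
  | |- forall x, continuous_at x (fun y => (- @?A y)%R) => apply: (@contN _ _ A); cont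
  | |- forall x, continuous_at x (fun y => (@?A y * @?B y)%R) => apply: (@contM _ _ A B); cont
  | |- forall x, continuous_at x (fun y => (@?A y ^+ _)%R) => apply: (@contX _ _ A); cont
  | |- forall x, continuous_at x (fun y => `|@?A y|%R) => apply: (@cont_norm _ _ A); cont
  | |- forall x, continuous_at x (fun y => (@?A y *: @?B y)%R) => apply: (@cont_scalev _ _ _ A B); cont
  | |- forall x, continuous_at x (fun y => ?f y) =>
      first [ match goal with H : forall x, continuous_at x f |- _ => exact: H end
            | exact: cont_id | idtac ]
  | |- forall x, continuous_at x _ =>
      first [ exact: cont_cst | exact: cont_id | (apply: cont_sum => ? ?; cont)
            | (apply: cont_prod => ? ?; cont) | idtac ]
  | |- _ => try by []
  end.

(** * Averages over the unit cube *)
Section rectangle.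
Context d1 d2 (T1 : measurableType d1) (T2 : measurableType d2) (R : realType).
Variables (m1 : {sigma_finite_measure set T1 -> \bar R}).
Variables (m2 : {sigma_finite_measure set T2 -> \bar R}).
Variables (A : set T1) (B : set T2) (f : T1 * T2 -> R) (M : R).
Hypotheses (mA : measurable A) (mB : measurable B).
Hypotheses (m1A : (m1 A < +oo)%E) (m2B : (m2 B < +oo)%E).
Hypothesis mf : measurable_fun setT f.
Hypothesis fM : forall x y, A x -> B y -> `|f (x, y)| <= M.

Lemma integrable_rectangle : (m1 \x m2)%E.-integrable (A `*` B) (EFin \o f).
Proof.
apply: measurable_bounded_integrable.
- exact: measurableX.
- rewrite [X in (X < _)%E](_ : _ = m1 A * m2 B)%E; last exact: product_measure1E.
  by rewrite lte_mul_pinfty// ge0_fin_numE.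
- exact: measurable_funTS.
- exists M; split; first exact: num_real.
  by move=> N MN [x y] [/= Ax By]; apply: (le_trans (fM Ax By)); exact: ltW.
Qed.

Lemma integrable_section1 x : A x -> m2.-integrable B (fun y => (f (x, y))%:E).
Proof.
move=> Ax; apply: (@measurable_bounded_integrable _ _ _ m2 (fun y => f (x, y))) => //.
  by apply/measurable_funTS; apply: measurableT_comp => //; exact: measurable_pair1.
exists M; split; first exact: num_real.
by move=> N MN y By; apply: (le_trans (fM Ax By)); exact: ltW.
Qed.

Lemma integrable_section2 y : B y -> m1.-integrable A (fun x => (f (x, y))%:E).
Proof.
move=> By; apply: (@measurable_bounded_integrable _ _ _ m1 (fun x => f (x, y))) => //.
  by apply/measurable_funTS; apply: measurableT_comp => //; exact: measurable_pair2.
exists M; split; first exact: num_real.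
by move=> N MN x Ax; apply: (le_trans (fM Ax By)); exact: ltW.
Qed.

Lemma Rintegral_rectangle1 :
  \int[(m1 \x m2)%E]_(z in A `*` B) f z =
  \int[m1]_(x in A) \int[m2]_(y in B) f (x, y).
Proof.
rewrite /Rintegral; congr fine.
have /(integrable_mkcond _ (measurableX mA mB)) fi := integrable_rectangle.
rewrite integral_mkcond -integral12_prod_meas1//= [RHS]integral_mkcond.
apply: eq_integral => x _; rewrite /patch; case: ifPn => [|] xA.
  rewrite fineK; last by apply: integrable_fin_num => //; apply: integrable_section1; rewrite inE in xA.
  rewrite [RHS]integral_mkcond; apply: eq_integral => y _; rewrite /patch /=.
  by rewrite in_setX /= xA.
by apply: integral0_eq => y _; rewrite in_setX/= (negbTE xA).
Qed.

Lemma Rintegral_rectangle2 :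
  \int[(m1 \x m2)%E]_(z in A `*` B) f z =
  \int[m2]_(y in B) \int[m1]_(x in A) f (x, y).
Proof.
rewrite /Rintegral; congr fine.
have /(integrable_mkcond _ (measurableX mA mB)) fi := integrable_rectangle.
rewrite integral_mkcond -integral21_prod_meas1//= [RHS]integral_mkcond.
apply: eq_integral => y _; rewrite /patch; case: ifPn => [|] yB.
  rewrite fineK; last by apply: integrable_fin_num => //; apply: integrable_section2; rewrite inE in yB.
  rewrite [RHS]integral_mkcond; apply: eq_integral => x _; rewrite /patch /=.
  by rewrite in_setX /= yB andbT.
by apply: integral0_eq => x _; rewrite in_setX/= (negbTE yB) andbF.
Qed.

End rectangle.

Section cube.
Context {R : realType}.
Implicit Type n : nat.

(** The cube has volume 1, so the integral over it is a mean value; for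
    periodic functions it is the integral over the torus. *)
Definition avg n (f : 'rV[R]_n -> R) : R := \int[lebesgueRn n]_(x in cube) f x.

Lemma measurable_continuous n (f : 'rV[R]_n -> R) : continuous f ->
  measurable_fun setT (f : borelRn R n -> measurableTypeR R).
Proof.
move=> cf; apply: (measurability _ (RGenOpens.measurableE R)).
move=> _ [_ [a [b ->] <-]]; rewrite setTI; apply: sub_sigma_algebra.
by have /continuousP := cf; apply; exact: interval_open.
Qed.

Lemma measurable_cube n : measurable (cube : set (borelRn R n)).
Proof.
rewrite (_ : cube = \bigcap_(i : 'I_n) ((fun x : 'rV[R]_n => x 0 i) @^-1` `[0, 1[%classic)); last first.
  apply/seteqP; split => [x xc i _|x xc i] /=; first by rewrite in_itv/=; exact: xc.
  by have /(_ I) := xc i; rewrite /= in_itv.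
apply: fin_bigcap_measurable; first exact: finite_finset.
move=> i _; rewrite -[X in measurable X]setTI.
by apply: (@measurable_continuous n _ (@coord_continuous R 1 n 0 i)).
Qed.

Lemma preimage_cons_cube n :
  @consRn R n @^-1` cube = (`[0%R, 1%R[%classic `*` cube).
Proof.
apply/seteqP; split => [[t y]/= h|[t y] [/= t01 yc] i].
  split => /=; first by have := h ord0; rewrite mxE unlift_none in_itv.
  by move=> j; have := h (lift ord0 j); rewrite mxE liftK.
rewrite mxE; case: unliftP => [j _|_] /=; first exact: yc.
by move: t01; rewrite in_itv.
Qed.

Lemma lebesgue_itv01 : lebesgue_measure (`[0, 1[%classic : set R) = 1%E.
Proof. by rewrite lebesgue_measure_itv/= lte_fin ltr01 oppr0 adde0. Qed.

Lemma lebesgueRn_cube n : lebesgueRn n (cube : set 'rV[R]_n) = 1%E.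
Proof.
elim: n => [|n IH].
  by rewrite /= diracE mem_set//= => -[].
rewrite /= /lebesgueRn_step /pushforward preimage_cons_cube.
rewrite product_measure1E//; last exact: measurable_cube.
by rewrite IH mule1; exact: lebesgue_itv01.
Qed.

Lemma lebesgueRn_cube_lty n : (lebesgueRn n (cube : set 'rV[R]_n) < +oo)%E.
Proof. by rewrite [X in (X < _)%E](_ : _ = 1%E) ?ltry//; exact: lebesgueRn_cube. Qed.

(** Pointwise estimates are made on this compact set, where continuous
    functions are bounded. *)
Definition closed_cube n : set 'rV[R]_n := [set x | forall i, 0 <= x 0 i <= 1].

Lemma compact_closed_cube n : compact (@closed_cube n).
Proof.
have := @rV_compact R n (fun=> `[0, 1]%classic) (fun=> @segment_compact _ _ _).
by congr compact; apply/seteqP; split => x xc i; have := xc i; rewrite /= in_itv.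
Qed.

Lemma sub_closed_cube n : (cube : set 'rV[R]_n) `<=` @closed_cube n.
Proof. by move=> x xc i; have /andP[-> /ltW] := xc i. Qed.

Lemma bounded_on_cube n (f : 'rV[R]_n -> R) : continuous f ->
  exists M : R, forall x, closed_cube x -> `|f x| <= M.
Proof.
move=> cf; have [M [_ Mf]] := compact_bounded
  (continuous_compact (continuous_subspaceT cf) (@compact_closed_cube n)).
exists (M + 1) => x xc; apply: (Mf (M + 1)); first by rewrite ltrDl.
by exists x.
Qed.

Lemma cont_integrable n (f : 'rV[R]_n -> R) : continuous f ->
  (lebesgueRn n).-integrable cube (EFin \o f).
Proof.
move=> cf; apply: (@measurable_bounded_integrable _ _ _ (lebesgueRn n) f).
- exact: measurable_cube.
- exact: lebesgueRn_cube_lty.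
- by apply: measurable_funTS; exact: measurable_continuous.
- have [M fM] := bounded_on_cube cf.
  exists M; split; first exact: num_real.
  by move=> N MN x /sub_closed_cube xc; apply: (le_trans (fM x xc)); exact: ltW.
Qed.

Lemma avg_ge0 n (f : 'rV[R]_n -> R) : (forall x, 0 <= f x) -> 0 <= avg f.
Proof. by move=> f0; apply: Rintegral_ge0 => x _; exact: f0. Qed.

Lemma avg_cst n (c : R) : avg (fun _ : 'rV[R]_n => c) = c.
Proof.
rewrite /avg Rintegral_cst; last exact: measurable_cube.
by rewrite [X in fine X](_ : _ = 1%E) ?mulr1//; exact: lebesgueRn_cube.
Qed.

Lemma avgD n (f g : 'rV[R]_n -> R) : continuous f -> continuous g ->
  avg (fun x => f x + g x) = avg f + avg g.
Proof.
by move=> cf cg; apply: RintegralD; [exact: measurable_cube|exact: cont_integrable..].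
Qed.

Lemma avgB n (f g : 'rV[R]_n -> R) : continuous f -> continuous g ->
  avg (fun x => f x - g x) = avg f - avg g.
Proof.
by move=> cf cg; apply: RintegralB; [exact: measurable_cube|exact: cont_integrable..].
Qed.

Lemma avgZ n (c : R) (f : 'rV[R]_n -> R) : continuous f ->
  avg (fun x => c * f x) = c * avg f.
Proof.
by move=> cf; apply: RintegralZl; [exact: measurable_cube|exact: cont_integrable].
Qed.

Lemma avg_le n (f g : 'rV[R]_n -> R) : continuous f -> continuous g ->
  (forall x, closed_cube x -> f x <= g x) -> avg f <= avg g.
Proof.
move=> cf cg fg; apply: le_Rintegral; [exact: measurable_cube|exact: cont_integrable..|].
by move=> x /sub_closed_cube/fg.
Qed.

Lemma avgN n (f : 'rV[R]_n -> R) : continuous f -> avg (fun x => - f x) = - avg f.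
Proof.
move=> cf; rewrite -mulN1r -avgZ//; congr avg.
by apply/funext => x; rewrite mulN1r.
Qed.

Lemma avg_sum n (I : Type) (r : seq I) (F : I -> 'rV[R]_n -> R) :
  (forall i, continuous (F i)) ->
  avg (fun x => \sum_(i <- r) F i x) = \sum_(i <- r) avg (F i).
Proof.
move=> cF; elim: r => [|i r IH].
  by under eq_fun do rewrite big_nil; rewrite avg_cst big_nil.
under eq_fun do rewrite big_cons.
by rewrite big_cons avgD ?IH//; cont.
Qed.

Lemma le_norm_avg n (f : 'rV[R]_n -> R) : continuous f ->
  `|avg f| <= avg (fun x => `|f x|).
Proof.
move=> cf; rewrite ler_norml -avgN; last by cont.
by apply/andP; split; apply: avg_le => [||x _]; cont; [exact: lerNnormlW|exact: ler_norm].
Qed.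

Lemma avg_dist n (f g : 'rV[R]_n -> R) e : continuous f -> continuous g ->
  (forall x, closed_cube x -> `|f x - g x| <= e) -> `|avg f - avg g| <= e.
Proof.
move=> cf cg fg; rewrite -avgB// (le_trans (le_norm_avg _))//; first by cont.
by rewrite -[leRHS](@avg_cst n); apply: avg_le; cont.
Qed.

Lemma eq_avg n (f g : 'rV[R]_n -> R) : (forall x, closed_cube x -> f x = g x) ->
  avg f = avg g.
Proof. by move=> fg; apply: eq_Rintegral => x; rewrite inE => /sub_closed_cube/fg. Qed.

Lemma continuous_consRn n :
  continuous (fun p : R * 'rV[R]_n => consRn p : 'rV[R]_n.+1).
Proof.
move=> [t y] A /nbhs_ballP[e /= e0 eA]; apply/nbhs_ballP; exists e => //=.
move=> [t' y'] [/= tt' [_ yy']]; apply: eA; split => // i j; rewrite !mxE.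
by case: unliftP => [j' _|_] /=; [exact: yy'|exact: tt'].
Qed.

Lemma closed_cube_cons n (t : R) (y : 'rV[R]_n) : 0 <= t <= 1 -> closed_cube y ->
  closed_cube (consRn (t, y) : 'rV[R]_n.+1).
Proof. by move=> t01 yc i; rewrite mxE; case: unliftP => [j _|_]//=; exact: yc. Qed.

End cube.

(** * Fubini and limits of averages *)
Section fubini.
Context {R : realType}.
Implicit Type n : nat.

Let lebesgue_itv01_lty : (lebesgue_measure (`[0%R, 1%R[%classic : set R) < +oo)%E.
Proof. by rewrite lebesgue_itv01 ltry. Qed.

Let measurable_comp_cons n (f : 'rV[R]_n.+1 -> R) : continuous f ->
  measurable_fun setT (f \o @consRn R n).
Proof.
move=> /measurable_continuous mf.
exact: (measurableT_comp mf (@measurable_consRn R n)).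
Qed.

Let bounded_comp_cons n (f : 'rV[R]_n.+1 -> R) : continuous f ->
  exists M : R, forall t y, (`[0%R, 1%R[%classic : set R) t -> (cube : set 'rV[R]_n) y ->
     `|(f \o @consRn R n) (t, y)| <= M.
Proof.
move=> cf; have [M fM] := bounded_on_cube cf; exists M => t y /=.
rewrite in_itv/= => /andP[t0 t1] /sub_closed_cube yc.
by apply: fM; apply: closed_cube_cons => //; rewrite t0 ltW.
Qed.

Let avg_pushforward n (f : 'rV[R]_n.+1 -> R) : continuous f ->
  avg f = \int[(lebesgue_measure \x lebesgueRn n)%E]_(z in `[0%R, 1%R[%classic `*` cube)
            (f \o @consRn R n) z.
Proof.
move=> cf; rewrite /avg /Rintegral; congr fine.
have [M fM] := bounded_comp_cons cf.
rewrite -preimage_cons_cube.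
apply: (@integral_pushforward _ _ _ _ R (@consRn R n) (@measurable_consRn R n)
  (lebesgue_measure \x lebesgueRn n)%E cube (EFin \o f)).
- by apply/measurable_EFinP; exact: measurable_continuous.
- rewrite preimage_cons_cube.
  exact: (integrable_rectangle _ (@measurable_cube R n) lebesgue_itv01_lty
    (@lebesgueRn_cube_lty R n) (measurable_comp_cons cf) fM).
- exact: measurable_cube.
Qed.

(** Fubini for the recursive construction of the measure on the space of
    dimension n.+1, with the first coordinate integrated last; the next lemma
    integrates it first. *)
Lemma avg_cons1 n (f : 'rV[R]_n.+1 -> R) : continuous f ->
  avg f = \int[lebesgue_measure]_(t in `[0%R, 1%R[) avg (fun y => f (consRn (t, y))).
Proof.
move=> cf; rewrite avg_pushforward//; have [M fM] := bounded_comp_cons cf.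
exact: (Rintegral_rectangle1 _ (@measurable_cube R n) lebesgue_itv01_lty
    (@lebesgueRn_cube_lty R n) (measurable_comp_cons cf) fM).
Qed.

Lemma avg_cons2 n (f : 'rV[R]_n.+1 -> R) : continuous f ->
  avg f = avg (fun y => \int[lebesgue_measure]_(t in `[0%R, 1%R[) f (consRn (t, y))).
Proof.
move=> cf; rewrite avg_pushforward//; have [M fM] := bounded_comp_cons cf.
exact: (Rintegral_rectangle2 _ (@measurable_cube R n) lebesgue_itv01_lty
    (@lebesgueRn_cube_lty R n) (measurable_comp_cons cf) fM).
Qed.

(** The measurable sets of the product are generated by boxes, whereas
    continuity gives open preimages: an open set is the union of the boxes with
    rational centre and radius that it contains. *)
Lemma measurable_continuous2 n (F : 'rV[R]_n * 'rV[R]_n -> R) : continuous F ->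
  measurable_fun setT (F : borelRn R n * borelRn R n -> measurableTypeR R).
Proof.
move=> cF; apply: (measurability _ (RGenOpens.measurableE R)).
move=> _ [_ [a [b ->] <-]]; rewrite setTI; set V := _ @^-1` _.
have oV : open (V : set ('rV[R]_n * 'rV[R]_n)).
  by have /continuousP := cF; apply; exact: interval_open.
pose box (c : 'rV[rat]_n * 'rV[rat]_n * nat) : set (borelRn R n * borelRn R n) :=
  ball (map_mx ratr c.1.1 : 'rV[R]_n) (c.2.+1%:R^-1) `*`
  ball (map_mx ratr c.1.2 : 'rV[R]_n) (c.2.+1%:R^-1).
have mbox c : measurable (box c).
  by apply: measurableX; apply: sub_sigma_algebra; exact: ball_open.
pose G c := if `[< box c `<=` V >] then box c else set0.
rewrite (_ : V = \bigcup_c G c); last first.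
  apply/seteqP; split => [[x y] Vxy|p [c _]]; last first.
    by rewrite /G; case: asboolP => // + /[dup] => /[apply].
  have /nbhs_ballP[e /= e0 eV] : nbhs ((x, y) : 'rV[R]_n * 'rV[R]_n) V.
    by apply: open_nbhs_nbhs; split.
  have [k ke] : exists k : nat, k.+1%:R^-1 < e / 2.
    by exists (Num.truncn (e / 2)^-1); rewrite invf_plt ?posrE ?divr_gt0// truncnS_gt.
  have k0 : 0 < k.+1%:R^-1 :> R by rewrite invr_gt0 ltr0n.
  have approx (u : 'rV[R]_n) : exists v : 'rV[rat]_n, ball (map_mx ratr v : 'rV[R]_n) k.+1%:R^-1 u.
    have /choice[v vu] : forall j, exists q : rat, `|ratr q - u 0 j| < k.+1%:R^-1.
      move=> j; have [|q] := @rat_in_itvoo R (u 0 j - k.+1%:R^-1) (u 0 j + k.+1%:R^-1).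
        by rewrite ltrD2l (lt_trans _ k0)// oppr_lt0.
      by rewrite in_itv/= => /andP[q1 q2]; exists q; rewrite ltr_distl q1 q2.
    by exists (\row_j v j); split => // i j; rewrite !mxE ord1; exact: vu.
  have [v vx] := approx x; have [w wy] := approx y.
  exists (v, w, k) => //; rewrite /G asboolT// => -[x' y'] [/= vx' wy']; apply: eV.
  have h (u u1 u2 : 'rV[R]_n) : ball u k.+1%:R^-1 u1 -> ball u k.+1%:R^-1 u2 -> ball u1 e u2.
    move=> /ball_sym u1u uu2; apply: (@le_ball _ _ _ (k.+1%:R^-1 + k.+1%:R^-1)).
      by rewrite [leRHS]splitr lerD// ltW.
    exact: ball_triangle u1u uu2.
  by split; [exact: h vx vx'|exact: h wy wy'].
apply: countable_bigcupT_measurable => [|c]; first exact: countableP.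
by rewrite /G; case: asboolP.
Qed.

Lemma avg_swap n (F : 'rV[R]_n * 'rV[R]_n -> R) : continuous F ->
  avg (fun x => avg (fun y => F (x, y))) = avg (fun y => avg (fun x => F (x, y))).
Proof.
move=> cF.
have [M FM] : exists M : R, forall x y, (cube : set 'rV[R]_n) x ->
    (cube : set 'rV[R]_n) y -> `|F (x, y)| <= M.
  have [M [_ MF]] := compact_bounded (continuous_compact (continuous_subspaceT cF)
    (compact_setX (@compact_closed_cube R n) (@compact_closed_cube R n))).
  exists (M + 1) => x y /sub_closed_cube xc /sub_closed_cube yc.
  by apply: (MF (M + 1)); [rewrite ltrDl|exists (x, y)].
have mF := measurable_continuous2 cF.
have mC := @measurable_cube R n; have C1 := @lebesgueRn_cube_lty R n.
exact: (etrans (esym (Rintegral_rectangle1 mC mC C1 C1 mF FM))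
  (Rintegral_rectangle2 mC mC C1 C1 mF FM)).
Qed.

(** Convergence near every point of the compact closed cube is uniform (tube
    lemma), hence passes to the averages. This single principle serves for the
    continuity of averages in a parameter and for their derivatives. *)
Lemma avg_cvg n (I : Type) (Fl : set_system I) (FF : Filter Fl) (F : I -> 'rV[R]_n -> R)
    (g : 'rV[R]_n -> R) : continuous g -> (\forall i \near Fl, continuous (F i)) ->
  (forall x, closed_cube x -> forall e, 0 < e ->
     \forall x' \near x & i \near Fl, `|F i x' - g x| < e) ->
  avg (F i) @[i --> Fl] --> avg g.
Proof.
move=> cg cF Fg; apply/cvgrPdist_le => e e0.
have e20 : 0 < e / 2 by rewrite divr_gt0.
have : \forall i \near Fl, (@closed_cube R n) `<=` (fun x => `|F i x - g x| <= e).
  have /compact_near_coveringP := @compact_closed_cube R n; apply => x xc.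
  have gx : \forall x' \near x, `|g x' - g x| < e / 2.
    by have /cvgrPdist_lt/(_ _ e20) := cg x; apply: filterS => x'; rewrite distrC.
  have /= := Fg x xc _ e20; case=> -[P Q] /= [Px QF] PQ.
  exists ((P `&` [set x' | `|g x' - g x| < e / 2]), Q) => /=.
    by split => //; exact: filterI.
  move=> [x' i] /= [[Px' gx'] Qi].
  have := PQ (x', i) (conj Px' Qi) => /= Fix.
  rewrite -(subrKA (g x)) (le_trans (ler_normD _ _))// [leRHS]splitr lerD//; first exact: ltW.
  by rewrite distrC ltW.
apply: filter_app; move: cF; apply: filterS => i cFi Fig.
by apply: avg_dist => // x xc; rewrite distrC; exact: Fig.
Qed.

End fubini.

(** * Derivatives along lines *)
Section derivatives.
Context {R : realType} {V : normedModType R}.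
Implicit Types (f g : V -> R) (x v : V).

(** Directional derivatives are derivatives of functions of one real variable,
    which reduces the rules below to one dimension. *)
Lemma is_derive_slice f x v (s df : R) :
  is_derive (x + s *: v) v f df <->
  is_derive s (1 : R) (fun h => f (x + h *: v)) df.
Proof.
have E : (fun h : R => h^-1 *: ((f \o shift (x + s *: v)) (h *: v) - f (x + s *: v))) =
         (fun h : R => h^-1 *: (((fun h => f (x + h *: v)) \o shift s) (h *: 1) - f (x + s *: v))).
  apply/funext => h; congr (_ *: (f _ - _)) => /=.
  by rewrite scalerDl -[h *: 1]/(h * 1) mulr1 addrCA.
split=> -[d1 d2]; split.
- by move: d1; rewrite /derivable E.
- by move: d2; rewrite /derive E.
- by move: d1; rewrite /derivable -E.
- by move: d2; rewrite /derive -E.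
Qed.

Lemma eq_is_derive f g x v df : f =1 g -> is_derive x v f df -> is_derive x v g df.
Proof. by move=> /funext ->. Qed.

Lemma is_derive_add f g x v df dg : is_derive x v f df -> is_derive x v g dg ->
  is_derive x v (fun y => f y + g y) (df + dg).
Proof. by move=> ? ?; exact: is_deriveD. Qed.

Lemma is_derive_opp f x v df : is_derive x v f df -> is_derive x v (fun y => - f y) (- df).
Proof. by move=> ?; exact: is_deriveN. Qed.

Lemma is_derive_sub f g x v df dg : is_derive x v f df -> is_derive x v g dg ->
  is_derive x v (fun y => f y - g y) (df - dg).
Proof. by move=> ? ?; exact: is_deriveB. Qed.

Lemma is_derive_mul f g x v df dg : is_derive x v f df -> is_derive x v g dg ->
  is_derive x v (fun y => f y * g y) (df * g x + f x * dg).
Proof. by move=> ? ?; apply: is_derive_eq (is_deriveM _ _) _; rewrite addrC mulrC. Qed.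

Lemma is_derive_const x v (c : R) : is_derive x v (fun=> c) 0.
Proof. exact: is_derive_cst. Qed.

Lemma is_derive_scale (c : R) f x v df : is_derive x v f df ->
  is_derive x v (fun y => c * f y) (c * df).
Proof. by move=> ?; exact: is_deriveZ. Qed.

Lemma is_derive_sqr f x v df : is_derive x v f df ->
  is_derive x v (fun y => f y ^+ 2) (2 * f x * df).
Proof.
move=> d; apply: (eq_is_derive (f := fun y => f y * f y)) => //.
by apply: is_derive_eq (is_derive_mul d d) _; ring.
Qed.

Lemma is_derive_bigsum n (F : 'I_n -> V -> R) x v (dF : 'I_n -> R) :
  (forall i, is_derive x v (F i) (dF i)) ->
  is_derive x v (fun y => \sum_i F i y) (\sum_i dF i).
Proof.
elim: n F dF => [|n IH] F dF d.
  by rewrite big_ord0; apply: eq_is_derive (is_derive_const x v 0) => y; rewrite big_ord0.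
rewrite big_ord_recl; apply: eq_is_derive (is_derive_add (d ord0) (IH _ _ (fun i => d (lift ord0 i)))) => y.
by rewrite big_ord_recl.
Qed.

Lemma is_derive_compose (k : R -> R) f x v dk df : is_derive (f x) 1 k dk ->
  is_derive x v f df -> is_derive x v (fun y => k (f y)) (dk * df).
Proof.
move=> dkf; rewrite -{1}[x]addr0 -[0](scale0r v) => /is_derive_slice df0.
rewrite -[x]addr0 -[0](scale0r v); apply/is_derive_slice.
apply: (@is_derive1_comp _ k (fun h => f (x + h *: v)) 0) => //.
by rewrite scale0r addr0.
Qed.

Lemma mean_value (f g : V -> R) x v (s : R) : (forall y, is_derive y v f (g y)) ->
  exists2 c, `|c| <= `|s| & f (x + s *: v) - f x = s * g (x + c *: v).
Proof.
move=> fg; pose F h := f (x + h *: v); pose G h := g (x + h *: v).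
have dF (t : R) : is_derive t (1 : R) F (G t) by exact/is_derive_slice.
have cF : continuous F.
  by move=> t; apply/differentiable_continuous/derivable1_diffP; case: (dF t).
have E : f (x + s *: v) - f x = F s - F 0 by rewrite /F scale0r addr0.
rewrite E; case: (leP 0 s) => s0.
  have [c] := MVT_segment s0 (fun t _ => dF t) (continuous_subspaceT cF).
  rewrite in_itv/= subr0 => /andP[c0 cs] ->; exists c; last by rewrite mulrC.
  by rewrite !ger0_norm.
have [c] := MVT_segment (ltW s0) (fun t _ => dF t) (continuous_subspaceT cF).
rewrite in_itv/= sub0r => /andP[sc c0] H; exists c.
  by rewrite !ler0_norm// ?lerN2// ltW.
by rewrite -(opprB (F 0)) H mulrN opprK mulrC.
Qed.

End derivatives.

Lemma is_derive_idfun {R : realType} (s : R) : is_derive s (1 : R) (fun h => h) 1.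
Proof. exact: is_derive_id. Qed.

(** * The fundamental theorem of calculus on the line *)
Section real_integral.
Context {R : realType}.
Implicit Types f g : R -> R.
Local Notation mu := (@lebesgue_measure R).

Lemma cont_itv_integrable f (a b : R) : continuous f -> mu.-integrable `[a, b] (EFin \o f).
Proof.
move=> cf; apply: continuous_compact_integrable; first exact: segment_compact.
exact: continuous_subspaceT.
Qed.

(** Near x the oriented integral from 0 differs by a constant from the integral
    with a fixed lower bound a to the left of both 0 and x, to which the usual
    theorem applies. *)
Lemma is_derive_oriented_integral f (x : R) : continuous f ->
  is_derive x (1 : R) (fun s => oriented_integral 0 s f) (f x).
Proof.
move=> cf; pose u := `|x| + 1; pose a := - u.
have [ax xu] : a < x /\ x < u by apply/andP; rewrite -ltr_norml ltrDl.
have u0 : 0 < u by rewrite ltr_wpDl.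
have a0 : a < 0 by rewrite oppr_lt0.
have fi := cont_itv_integrable a u cf.
have [dF F'] := continuous_FTC1_closed xu fi ax (cf x).
set F := (fun s => _) in dF F'.
have itv_sub s t : s <= t -> a < s -> F t - F s = \int[mu]_(r in `[s, t]) f r.
  move=> st sa; rewrite /F.
  rewrite (@Rintegral_itvB _ f (BLeft a) (BRight t) s)//; last first.
  - by rewrite bnd_simp ltW.
  - exact: cont_itv_integrable.
  apply: Rintegral_itv_obnd_cbnd.
  by apply: integrableS (cont_itv_integrable s t cf) => //; exact: subset_itv_oc_cc.
have dFx : is_derive x (1 : R) F (f x).
  by split; [exact: dF|by rewrite -derive1E; exact: F'].
apply: (@near_eq_is_derive _ _ _ (fun s => F s - F 0)).
  near=> s; have as' : a < s by near: s; exact: lt_nbhsr.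
  rewrite /oriented_integral; case: leP => s0; first exact: itv_sub.
  by rewrite -itv_sub ?opprB// ltW.
by apply: is_derive_eq (is_derive_sub dFx (is_derive_const _ _ (F 0))) _; rewrite subr0.
Unshelve. all: by end_near. Qed.

Lemma FTC2_closed F f (a b : R) : a < b -> continuous f ->
  (forall t : R, is_derive t (1 : R) F (f t)) -> \int[mu]_(t in `[a, b]) f t = F b - F a.
Proof.
move=> ab cf dF.
have cF : continuous F.
  by move=> t; apply/differentiable_continuous/derivable1_diffP; case: (dF t).
rewrite /Rintegral (continuous_FTC2 ab (continuous_subspaceT cf) (F := F))//.
- split; first by move=> x _; case: (dF x).
    exact/cvg_at_right_filter/cF.
  exact/cvg_at_left_filter/cF.
- by move=> x _; rewrite derive1E; case: (dF x).
Qed.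

Lemma FTC2_unit F f : continuous f ->
  (forall t : R, is_derive t (1 : R) F (f t)) -> \int[mu]_(t in `[0%R, 1%R[) f t = F 1 - F 0.
Proof.
move=> cf dF; rewrite Rintegral_itv_bndo_bndc; first exact: FTC2_closed.
by apply: integrableS (cont_itv_integrable 0 1 cf) => //; exact: subset_itv_co_cc.
Qed.

(** With an antiderivative F, the integral of the translate is
    F (v + 1) - F v, whose derivative in v vanishes by periodicity. *)
Lemma Rintegral_shift f (v : R) : continuous f -> (forall t, f (t + 1) = f t) ->
  \int[mu]_(t in `[0%R, 1%R[) f (t + v) = \int[mu]_(t in `[0%R, 1%R[) f t.
Proof.
move=> cf f1; pose F s := oriented_integral 0 s f.
have dF (x : R) : is_derive x (1 : R) F (f x) by exact: is_derive_oriented_integral.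
have dFv (w t : R) : is_derive t (1 : R) (fun t => F (t + w)) (f (t + w)).
  apply: is_derive_eq (is_derive_compose (f := fun t => t + w) (dF _) (is_derive_add (is_derive_id _ _) (is_derive_const _ _ w))) _.
  by rewrite addr0 mulr1.
rewrite (@FTC2_unit (fun t => F (t + v))) //; last first.
  exact: (cont_comp (contD (@cont_id _) (@cont_cst _ _ v)) cf).
rewrite (@FTC2_unit F)// add0r.
have dG (w : R) : is_derive w (1 : R) (fun w => F (w + 1) - F w) 0.
  by apply: is_derive_eq (is_derive_sub (dFv 1 w) (dF w)) _; rewrite f1 subrr.
by have := is_derive_0_is_cst v 0 dG; rewrite add0r (addrC v).
Qed.

End real_integral.

(** * Translation invariance and the divergence theorem on the cube *)
Section averages.
Context {R : realType}.
Implicit Type n : nat.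

Lemma avg_continuous n (T : topologicalType) (F : T -> 'rV[R]_n -> R) :
  continuous (fun p : T * 'rV[R]_n => F p.1 p.2) -> continuous (fun t => avg (F t)).
Proof.
move=> cF t; have cFt s : continuous (F s).
  exact: (cont_comp (cont_pair (@cont_cst _ _ s) (@cont_id _)) cF).
apply: avg_cvg; first exact: cFt.
  by apply: nearW => s; exact: cFt.
move=> x _ e e0; have /cvgrPdist_lt/(_ e e0) := cF (t, x).
rewrite /= => -[[P Q] /= [Pt Qx] PQ]; exists (Q, P) => //= -[x' s] [/= Qx' Ps].
by rewrite distrC; exact: (PQ (s, x')).
Qed.

(** By induction on the dimension: the inner average is translated by the
    induction hypothesis, and the outer integral by the one-dimensional case. *)
Lemma avg_shift n (f : 'rV[R]_n -> R) (v : 'rV[R]_n) : continuous f -> Defs.periodic f ->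
  avg (fun x => f (x + v)) = avg f.
Proof.
elim: n f v => [|n IH] f v cf pf.
  by apply: eq_avg => x _; congr f; apply/rowP => -[].
have cfs (u : 'rV[R]_n.+1) : continuous (fun x : 'rV[R]_n.+1 => f (x + u)).
  exact: (cont_comp (cont_addv (@cont_id _) (@cont_cst _ _ u)) cf).
rewrite (avg_cons1 (cfs v)) (avg_cons1 cf).
pose g t := avg (fun y => f (consRn (t, y))).
pose v0 := v 0 0; pose v' := \row_j v 0 (lift ord0 j).
have cfc : continuous (fun p : R * 'rV[R]_n => f (consRn p)).
  exact: (cont_comp (@continuous_consRn R n) cf).
have cg : continuous g by exact: (@avg_continuous n _ (fun t y => f (consRn (t, y)))).
have cft t : continuous (fun y : 'rV[R]_n => f (consRn (t, y))).
  exact: (cont_comp (cont_pair (@cont_cst _ _ t) (@cont_id _)) cfc).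
transitivity (\int[lebesgue_measure]_(t in `[0%R, 1%R[) g (t + v0)).
  apply: eq_Rintegral => t _; rewrite -[RHS](IH (fun y => f (consRn (t + v0, y))) v')//.
    apply: eq_avg => y _; congr f; apply/rowP => j; rewrite !mxE.
    by case: unliftP => [i ->|->] /=; rewrite ?mxE.
  move=> y z; rewrite -[RHS](pf _ (\row_j oapp (fun i => z 0 i) 0 (unlift ord0 j))).
  congr f; apply/rowP => j; rewrite !mxE.
  by case: unliftP => [i _|_] /=; rewrite ?mxE// addr0.
apply: Rintegral_shift => // t; apply: eq_avg => y _.
rewrite -[RHS](pf _ (\row_j oapp (fun _ => 0) 1 (unlift ord0 j))).
congr f; apply/rowP => j; rewrite !mxE.
by case: unliftP => [i _|_] /=; rewrite ?addr0.
Qed.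

(** Divergence theorem on the cube. Equality on opposite faces holds both for
    periodic functions and for functions vanishing on the boundary of the cube;
    the first is used on the torus, the second for the mollifier. *)
Lemma avg_derive0 n (i : 'I_n) (g dg : 'rV[R]_n -> R) :
  continuous g -> continuous dg ->
  (forall x : 'rV[R]_n, is_derive x (delta_mx 0 i) g (dg x)) ->
  (forall x : 'rV[R]_n, x 0 i = 0 -> g (x + delta_mx 0 i) = g x) -> avg dg = 0.
Proof.
elim: n i g dg => [[]//|n IH] i g dg cg cdg gdg g0.
have cons_cont (f : 'rV[R]_n.+1 -> R) (t : R) : continuous f ->
    continuous (fun y : 'rV[R]_n => f (consRn (t, y))).
  move=> cf.
  exact: (cont_comp (cont_pair (@cont_cst _ _ t) (@cont_id _)) (cont_comp (@continuous_consRn R n) cf)).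
have cons_cont2 (f : 'rV[R]_n.+1 -> R) (y : 'rV[R]_n) : continuous f ->
    continuous (fun t : R => f (consRn (t, y))).
  move=> cf.
  exact: (cont_comp (cont_pair (@cont_id _) (@cont_cst _ _ y)) (cont_comp (@continuous_consRn R n) cf)).
case: (unliftP ord0 i) => [j ij|i0].
  rewrite (avg_cons1 cdg).
  transitivity (\int[lebesgue_measure]_(t in `[0%R, 1%R[) (0 : R)).
    apply: eq_Rintegral => t _; apply: (IH j (fun y => g (consRn (t, y)))).
    - exact: cons_cont.
    - exact: cons_cont.
    - move=> y; rewrite -{1}[y]addr0 -[0](scale0r (delta_mx 0 j)).
      apply/is_derive_slice.
      have := gdg (consRn (t, y) + 0 *: delta_mx 0 i); rewrite {2}scale0r addr0 => /is_derive_slice.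
      apply: eq_is_derive => h; congr g; apply/rowP => k; rewrite !mxE ij.
      case: unliftP => [k' ->|->] /=; rewrite ?mxE ?eqxx/=.
        by rewrite (inj_eq (@lift_inj _ _)).
      by rewrite mulr0 addr0.
    - move=> y yj; rewrite -[RHS]g0; last by rewrite ij mxE liftK.
      congr g; apply/rowP => k; rewrite !mxE ij.
      case: unliftP => [k' ->|->] /=; rewrite ?mxE ?eqxx/=.
        by rewrite (inj_eq (@lift_inj _ _)).
      by rewrite addr0.
  by rewrite Rintegral_cst// mul0r.
rewrite (avg_cons2 cdg) -[RHS](@avg_cst R n 0); apply: eq_avg => y _.
transitivity (g (consRn (1, y)) - g (consRn (0, y))).
  apply: (@FTC2_unit R (fun t => g (consRn (t, y)))); first exact: cons_cont2.
  move=> t; have := gdg (consRn (0, y) + t *: delta_mx 0 i).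
  have E s : consRn (0, y) + s *: delta_mx 0 i = consRn (s, y) :> 'rV[R]_n.+1.
    apply/rowP => k; rewrite !mxE i0.
    case: unliftP => [k' ->|->] /=; rewrite ?mxE ?eqxx/= ?add0r ?mulr1//.
    by rewrite mulr0 addr0.
  by rewrite {2}E => /is_derive_slice; apply: eq_is_derive => s; rewrite E.
apply/eqP; rewrite subr_eq0; apply/eqP; rewrite -[RHS]g0; last by rewrite i0 mxE unlift_none.
congr g; apply/rowP => k; rewrite !mxE i0.
case: unliftP => [k' ->|->] /=; rewrite ?mxE ?eqxx/= ?add0r//.
by rewrite addr0.
Qed.

End averages.

(** * The Poincare inequality on the torus *)
Section torus.
Context {R : realType} {n : nat}.
Local Notation Rn := 'rV[R]_n.
Implicit Types (f g : Rn -> R) (x v : Rn).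

(** A derivative given as a second function, so that it can be computed by the
    rules for derivatives instead of through the choice of a limit. *)
Definition has_partial (i : 'I_n) f g : Prop :=
  forall x, is_derive x (delta_mx 0 i : Rn) f (g x).

Lemma periodic_basis f x i : Defs.periodic f -> f (x + delta_mx 0 i) = f x.
Proof. by move=> pf; rewrite -[RHS](pf x (delta_mx 0 i)) map_delta_mx. Qed.

Lemma periodic_partial f g i : Defs.periodic f -> has_partial i f g -> Defs.periodic g.
Proof.
move=> pf fg x z; case: (fg x) => _ <-; case: (fg (x + map_mx intr z)) => _ <-.
rewrite /derive; suff -> : (fun h : R => h^-1 *: ((f \o shift (x + map_mx intr z)) (h *: delta_mx 0 i)
  - f (x + map_mx intr z))) = (fun h : R => h^-1 *: ((f \o shift x) (h *: delta_mx 0 i) - f x)) by [].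
by apply/funext => h /=; rewrite addrA !pf.
Qed.

Lemma avg_partial0 f g i : continuous f -> continuous g -> Defs.periodic f ->
  has_partial i f g -> avg g = 0.
Proof.
by move=> cf cg pf fg; exact: (avg_derive0 cf cg fg (fun x _ => periodic_basis x i pf)).
Qed.

Lemma cont_shift f v : continuous f -> continuous (fun x => f (x + v)).
Proof. by move=> cf; exact: (cont_comp (cont_addv (@cont_id _) (@cont_cst _ _ v)) cf). Qed.

Lemma has_partial_coord i : has_partial i (fun y : Rn => y 0 i) (fun=> 1).
Proof.
move=> x; rewrite -[x]addr0 -[0](scale0r (delta_mx 0 i)); apply/is_derive_slice.
have d : is_derive (0 : R) (1 : R) (fun h : R => x 0 i + h) 1.
  by have := is_derive_add (is_derive_const (0 : R) (1 : R) (x 0 i)) (is_derive_idfun 0); rewrite add0r.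
by apply: eq_is_derive d => h; rewrite !mxE !eqxx mulr1.
Qed.

(** The fundamental theorem of calculus along the coordinate j, in which the
    integral over [0, 1] is written as an average over the cube: the function
    y -> f (x + s y_j e_j) - y_j (f (x + s e_j) - f x) takes equal values on
    opposite faces, so that the average of its derivative vanishes. Only
    averages then have to be interchanged. *)
Lemma shift_coord_avg f g j (x : Rn) (s : R) : continuous f -> continuous g -> has_partial j f g ->
  f (x + s *: delta_mx 0 j) - f x =
  avg (fun y : Rn => s * g (x + (s * y 0 j) *: delta_mx 0 j)).
Proof.
move=> cf cg fg; set D := _ - _.
have cline : continuous (fun y : Rn => x + (s * y 0 j) *: delta_mx 0 j : Rn).
  apply: cont_addv; first exact: cont_cst.
  apply: cont_scalev; last exact: cont_cst.
  by apply: contM; [exact: cont_cst|exact: coord_continuous].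
have cfl := cont_comp cline cf; have cgl := cont_comp cline cg.
have cc : continuous (fun y : Rn => y 0 j) by exact: coord_continuous.
have cgs : continuous (fun y : Rn => s * g (x + (s * y 0 j) *: delta_mx 0 j)) by cont.
apply/eqP; rewrite -subr_eq0 -oppr_eq0 opprB -(@avg_cst R n D) -avgB//; last by cont.
apply/eqP; apply: (@avg_derive0 _ _ j (fun y => f (x + (s * y 0 j) *: delta_mx 0 j) - y 0 j * D)).
- by cont.
- by cont.
- move=> y; apply: is_derive_sub; last first.
    by apply: is_derive_eq (is_derive_mul (@has_partial_coord j y) (is_derive_const _ _ D)) _; rewrite mul1r mulr0 addr0.
  have d := is_derive_scale s (@has_partial_coord j y).
  have dl : is_derive (s * y 0 j) (1 : R) (fun h => f (x + h *: delta_mx 0 j)) (g (x + (s * y 0 j) *: delta_mx 0 j)).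
    apply/(is_derive_slice f x (delta_mx 0 j)); exact: fg.
  have h := @is_derive_compose R Rn (fun h => f (x + h *: delta_mx 0 j)) (fun y : Rn => s * y 0 j) y (delta_mx 0 j) _ _ dl d.
  have E : g (x + (s * y 0 j) *: delta_mx 0 j) * (s * 1) = s * g (x + (s * y 0 j) *: delta_mx 0 j) by rewrite mulr1 mulrC.
  exact: (is_derive_eq h E).
- move=> y yj; rewrite !mxE !eqxx yj add0r mulr0 mulr1 mul0r subr0 scale0r addr0 mul1r.
  by rewrite /D opprB addrCA subrr addr0.
Qed.

Lemma periodic_norm f : Defs.periodic f -> Defs.periodic (fun x => `|f x|).
Proof. by move=> pf x z; rewrite pf. Qed.

(** The increment is the average of s times the derivative at intermediate
    points; exchanging the averages and translating removes these points. *)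
Lemma avg_shift_coord f g j (s : R) : continuous f -> continuous g -> Defs.periodic f ->
  has_partial j f g ->
  avg (fun x => `|f (x + s *: delta_mx 0 j) - f x|) <= `|s| * avg (fun x => `|g x|).
Proof.
move=> cf cg pf fg; have pg := periodic_partial pf fg.
have cline : continuous (fun p : Rn * Rn => p.1 + (s * p.2 0 j) *: delta_mx 0 j : Rn).
  apply: cont_addv; first exact: cont_fst.
  apply: cont_scalev; last exact: cont_cst.
  apply: contM; first exact: cont_cst.
  exact: (cont_comp (@cont_snd _ _) (@coord_continuous R 1 n 0 j)).
have cgn : continuous (fun x => `|g x|) by cont.
have cK := cont_comp cline cgn.
have cKs : continuous (fun p : Rn * Rn => `|s| * `|g (p.1 + (s * p.2 0 j) *: delta_mx 0 j)|) by cont.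
apply: (@le_trans _ _ (avg (fun x => avg (fun y => `|s| * `|g (x + (s * y 0 j) *: delta_mx 0 j)|)))).
  apply: avg_le.
  - by have ? := cont_shift (v := (s *: delta_mx 0 j)) cf; cont.
  - exact: (@avg_continuous _ _ _ (fun x y => `|s| * `|g (x + (s * y 0 j) *: delta_mx 0 j)|)).
  - move=> x _; rewrite (shift_coord_avg _ _ cf cg fg).
    apply: le_trans (le_norm_avg _) _.
      have := cont_comp (cont_pair (@cont_cst _ _ x) (@cont_id _)) (cont_comp cline cg) => /= ?.
      by cont.
    by rewrite le_eqVlt; apply/orP; left; apply/eqP/eq_avg => y _; rewrite normrM.
rewrite (@avg_swap _ _ (fun p => `|s| * `|g (p.1 + (s * p.2 0 j) *: delta_mx 0 j)|))//=.
rewrite -[leRHS](@avg_cst R n) le_eqVlt; apply/orP; left; apply/eqP/eq_avg => y _.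
rewrite avgZ; last exact: (cont_shift cgn).
by congr (_ * _); apply: (avg_shift _ cgn); exact: periodic_norm.
Qed.

Section gradient.
Variables (f : Rn -> R) (df : 'I_n -> Rn -> R).
Hypotheses (cf : continuous f) (pf : Defs.periodic f).
Hypotheses (cdf : forall j, continuous (df j)) (fdf : forall j, has_partial j f (df j)).

(** Moves along the coordinates one after the other, each increment being
    translated back to the origin. *)
Lemma avg_shift_le v :
  avg (fun x => `|f (x + v) - f x|) <= \sum_j `|v 0 j| * avg (fun x => `|df j x|).
Proof.
rewrite {1}[v]row_sum_delta; elim: (index_enum _) => [|j r IH].
  rewrite !big_nil -[leRHS](@avg_cst R n) le_eqVlt; apply/orP; left; apply/eqP/eq_avg => x _.
  by rewrite addr0 subrr normr0.
rewrite !big_cons; set S := \sum_(i <- r) _ in IH *.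
have cS := cont_shift (v := S) cf; have cj := cont_shift (v := v 0 j *: delta_mx 0 j) cf.
have h1 := avg_shift_coord (v 0 j) cf (@cdf j) pf (fdf j).
pose D x := `|f (x + S) - f x|; have cD : continuous D by rewrite /D; cont.
have pD : Defs.periodic D by move=> x z; rewrite /D pf addrAC pf.
apply: le_trans (lerD h1 IH).
rewrite -(avg_shift (v 0 j *: delta_mx 0 j) cD pD) -avgD; last 2 first.
- by cont.
- exact: (cont_shift cD).
apply: avg_le; last first.
- move=> x _; rewrite /D addrA [leRHS]addrC; exact: ler_distD.
- by have ? := cont_shift (v := (v 0 j *: delta_mx 0 j)) cD; cont.
- by have ? := cont_shift (v := (v 0 j *: delta_mx 0 j + S)) cf; cont.
Qed.

(** By periodicity avg f is the average of f (x + y) over y in the cube, so the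
    deviation is an average of increments over vectors with coordinates at
    most 1. *)
Lemma poincare : avg (fun x => `|f x - avg f|) <= \sum_j avg (fun x => `|df j x|).
Proof.
have cadd : continuous (fun p : Rn * Rn => p.1 + p.2 : Rn).
  by apply: cont_addv; [exact: cont_fst|exact: cont_snd].
have cfa := cont_comp cadd cf; have cf1 := cont_comp (@cont_fst Rn Rn) cf.
have cD : continuous (fun p : Rn * Rn => `|f (p.1 + p.2) - f p.1|) by cont.
apply: (@le_trans _ _ (avg (fun x => avg (fun y => `|f (x + y) - f x|)))).
  apply: avg_le; first by cont.
    exact: (@avg_continuous _ _ _ (fun x y => `|f (x + y) - f x|)).
  move=> x _; rewrite distrC -(avg_shift x cf pf) -{1}(@avg_cst R n (f x)) -avgB; last 2 first.
  - exact: (cont_shift cf).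
  - by cont.
  apply: le_trans (le_norm_avg _) _; first by have ? := cont_shift (v := x) cf; cont.
  by rewrite le_eqVlt; apply/orP; left; apply/eqP/eq_avg => y _; rewrite (addrC y).
rewrite (@avg_swap _ _ (fun p => `|f (p.1 + p.2) - f p.1|))//=.
rewrite -[leRHS](@avg_cst R n); apply: avg_le.
- have csw : continuous (fun p : Rn * Rn => (p.2, p.1)).
    by apply: cont_pair; [exact: cont_snd|exact: cont_fst].
  exact: (@avg_continuous _ _ _ (fun y x => `|f (x + y) - f x|) (cont_comp csw cD)).
- by cont.
move=> y yc; apply: le_trans (avg_shift_le y) _; apply: ler_sum => j _.
rewrite ler_piMl//; first by exact: avg_ge0.
by have /andP[y0 y1] := yc j; rewrite ger0_norm.
Qed.

End gradient.
End torus.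

(** * Derivatives of averages in a parameter *)
Section parameter.
Context {R : realType} {n : nat}.
Local Notation Rn := 'rV[R]_n.

(** Continuity in the pair (t, x), the hypothesis that makes convergence on the
    compact cube uniform. *)
Definition joint_cvg (F : R -> Rn -> R) (t0 : R) (x : Rn) : Prop :=
  forall e, 0 < e -> \forall x' \near x & t \near t0, `|F t x' - F t0 x| < e.

Lemma near0_dnbhs (d : R) : 0 < d -> \forall h \near (0 : R)^', `|h| < d /\ h != 0.
Proof.
move=> d0; have near_d : \forall h \near (0 : R)^', `|h| < d.
  apply: cvg_within; have := @nbhsx_ballx _ R (0 : R) d d0.
  by apply: filterS => h; rewrite /ball/= sub0r normrN.
have near_0 : \forall h \near (0 : R)^', h != 0 by exact: nbhs_dnbhs_neq.
by near=> h; split; near: h.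
Unshelve. all: by end_near. Qed.

Lemma shift_cvg F (t0 : R) x : joint_cvg F t0 x ->
  (fun p : Rn * R => F (p.2 + t0) p.1) @ filter_prod (nbhs x) ((0 : R)^') --> F t0 x.
Proof.
move=> jF; apply/cvgrPdist_lt => e e0.
have [[P1 P2] /= [P1x /nbhs_ballP[d /= d0 dP2]] PQ] := jF e e0.
exists (P1, [set h | `|h| < d /\ h != 0]) => /=.
  by split => //; exact: near0_dnbhs.
move=> [x' h] /= [P1x' [hd _]]; rewrite distrC; apply: (PQ (x', h + t0)); split => //=.
by apply: dP2; rewrite /ball/= opprD addrCA subrr addr0 normrN.
Qed.

(** The mean value theorem writes the difference quotient as dF at an
    intermediate time. *)
Lemma quotient_cvg (F dF : R -> Rn -> R) (t0 r : R) x : 0 < r ->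
  (forall t y, `|t - t0| < r -> is_derive t (1 : R) (fun s => F s y) (dF t y)) ->
  joint_cvg dF t0 x ->
  (fun p : Rn * R => p.2^-1 * (F (p.2 + t0) p.1 - F t0 p.1))
    @ filter_prod (nbhs x) ((0 : R)^') --> dF t0 x.
Proof.
move=> r0 dFF jF; apply/cvgrPdist_lt => e e0.
have [[P1 P2] /= [P1x /nbhs_ballP[d /= d0 dP2]] PQ] := jF e e0.
exists (P1, [set h | `|h| < Num.min d r /\ h != 0]) => /=.
  by split => //; apply: near0_dnbhs; rewrite lt_min d0.
move=> [x' h] /= [P1x' []]; rewrite lt_min => /andP[hd hr] h0.
have H t : `|t - t0| <= `|h| -> is_derive t (1 : R) (fun s => F s x') (dF t x').
  by move=> th; apply: dFF; exact: le_lt_trans th hr.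
have between (a b t : R) : `|a - t0| <= `|h| -> `|b - t0| <= `|h| ->
    a <= t <= b -> `|t - t0| <= `|h|.
  rewrite !ler_norml => /andP[? ?] /andP[? ?] /andP[? ?]; lra.
have cF (a b : R) : `|a - t0| <= `|h| -> `|b - t0| <= `|h| ->
    {within `[a, b], continuous (fun s => F s x')}.
  move=> ah bh; apply: derivable_within_continuous => t; rewrite in_itv/= => atb.
  by case: (H t (between a b t ah bh atb)).
have dF_itv (a b t : R) : `|a - t0| <= `|h| -> `|b - t0| <= `|h| -> t \in `]a, b[%R ->
    `|t - t0| <= `|h|.
  by rewrite in_itv/= => ah bh /andP[/ltW at_ /ltW tb]; apply: (between a b); rewrite ?at_.
have z0 : `|t0 - t0| <= `|h| by rewrite subrr normr0.
have zh : `|h + t0 - t0| <= `|h| by rewrite addrK.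
have [c ch ->] : exists2 c, `|t0 - c| <= `|h| & F (h + t0) x' - F t0 x' = h * dF c x'.
  case: (ltrgtP 0 h) => h0'; last by move: h0; rewrite -h0' eqxx.
    have tt : t0 < h + t0 by rewrite ltrDr.
    have [c cI ->] := MVT tt (fun t tI => H t (dF_itv _ _ t z0 zh tI)) (cF _ _ z0 zh).
    exists c; first by rewrite distrC; exact: (dF_itv _ _ c z0 zh cI).
    by rewrite addrK mulrC.
  have tt : h + t0 < t0 by rewrite gtrDr.
  have [c cI E] := MVT tt (fun t tI => H t (dF_itv _ _ t zh z0 tI)) (cF _ _ zh z0).
  exists c; first by rewrite distrC; exact: (dF_itv _ _ c zh z0 cI).
  by rewrite -opprB E opprD addrCA subrr addr0 mulrN opprK mulrC.
rewrite mulKf// distrC; apply: (PQ (x', c)) => /=; split => //.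
by apply: dP2; exact: le_lt_trans ch hd.
Qed.

(** G need only be continuous in time. This is what the Dirichlet energy
    requires: its increment is the average of an increment of phi times a sum of
    two Laplacians, and the Laplacian is not assumed differentiable in time. *)
Lemma is_derive_avg_mul (F dF G : R -> Rn -> R) (t0 r : R) : 0 < r ->
  (forall t, `|t - t0| < r -> continuous (F t)) ->
  (forall t, `|t - t0| < r -> continuous (G t)) -> continuous (dF t0) ->
  (forall t x, `|t - t0| < r -> is_derive t (1 : R) (fun s => F s x) (dF t x)) ->
  (forall x, closed_cube x -> joint_cvg dF t0 x) ->
  (forall x, closed_cube x -> joint_cvg G t0 x) ->
  is_derive t0 (1 : R) (fun t => avg (fun x => (F t x - F t0 x) * G t x))
    (avg (fun x => dF t0 x * G t0 x)).
Proof.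
move=> r0 cF cG cdF dFF jF jG; set g := fun t => _.
have t0r : `|t0 - t0| < r by rewrite subrr normr0.
have cF0 := cF t0 t0r; have cG0 := cG t0 t0r.
suff H : h^-1 *: ((g \o shift t0) (h *: (1 : R)) - g t0)
    @[h --> (0 : R)^'] --> avg (fun x => dF t0 x * G t0 x).
  by split; [apply/cvg_ex; exists (avg (fun x => dF t0 x * G t0 x))
            |exact: (cvg_lim (@Rhausdorff R) H)].
pose Q h x := h^-1 * (F (h + t0) x - F t0 x) * G (h + t0) x.
have near_c : \forall h \near (0 : R)^', continuous (F (h + t0)) /\ continuous (G (h + t0)).
  have := near0_dnbhs r0; apply: filterS => h [hr _].
  by split; [apply: cF|apply: cG]; rewrite addrK.
have H : avg (Q h) @[h --> (0 : R)^'] --> avg (fun x => dF t0 x * G t0 x).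
  apply: avg_cvg; first by cont.
    by move: near_c; apply: filterS => h [c1 c2]; rewrite /Q; cont.
  move=> x xc e e0.
  have cQ : (fun p : Rn * R => Q p.2 p.1) @ filter_prod (nbhs x) ((0 : R)^') --> dF t0 x * G t0 x.
    exact: (cvgM (quotient_cvg r0 dFF (jF x xc)) (shift_cvg (jG x xc))).
  have /cvgrPdist_lt/(_ e e0) := cQ.
  apply: filterS => -[x' h] /=.
  by rewrite distrC.
apply: cvg_trans H; apply: near_eq_cvg; move: near_c; apply: filterS => h [c1 c2] /=.
have g0 : g t0 = 0.
  by rewrite -[RHS](@avg_cst R n); apply: eq_avg => x _; rewrite subrr mul0r.
rewrite g0 subr0 /g -[h *: 1]/(h * 1) mulr1 -[_ *: _]/(_ * _) -avgZ; last by cont.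
by apply: eq_avg => x _; rewrite /Q mulrA.
Qed.

Lemma is_derive_avg (F dF : R -> Rn -> R) (t0 r : R) : 0 < r ->
  (forall t, `|t - t0| < r -> continuous (F t)) -> continuous (dF t0) ->
  (forall t x, `|t - t0| < r -> is_derive t (1 : R) (fun s => F s x) (dF t x)) ->
  (forall x, closed_cube x -> joint_cvg dF t0 x) ->
  is_derive t0 (1 : R) (fun t => avg (F t)) (avg (dF t0)).
Proof.
move=> r0 cF cdF dFF jF; have t0r : `|t0 - t0| < r by rewrite subrr normr0.
have j1 x : closed_cube x -> joint_cvg (fun _ _ => 1) t0 x.
  by move=> _ e e0; exists (setT, setT) => /=; [split; exact: filterT|rewrite subrr normr0].
have := is_derive_avg_mul r0 cF (fun _ _ => @cont_cst _ _ (1 : R)) cdF dFF jF j1.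
have -> : avg (fun x => dF t0 x * 1) = avg (dF t0) by apply: eq_avg => x _; rewrite mulr1.
move=> d; have := is_derive_add d (is_derive_const t0 (1 : R) (avg (F t0))); rewrite addr0.
apply: near_eq_is_derive.
have : \forall t \near t0, `|t0 - t| < r by exact: nbhsx_ballx.
apply: filterS => t tr; have ct : continuous (F t) by apply: cF; rewrite distrC.
have c0 := cF _ t0r.
rewrite -avgD; [|by cont..].
by apply: eq_avg => x _; rewrite mulr1 subrK.
Qed.

End parameter.

(** * Mollification and the multiplier estimate *)
Section mollifier.
Context {R : realType} {n : nat}.
Local Notation Rn := 'rV[R]_n.
Implicit Types (f g w : Rn -> R) (x y v : Rn) (delta : R).

(** A polynomial weight which is positive inside the cube and vanishes on its
    faces, so that integration by parts against it leaves no boundary term. *)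
Definition cutoff m (y : 'rV[R]_m) : R := \prod_j (y 0 j * (1 - y 0 j)).

Definition partial_cutoff (i : 'I_n) y : R :=
  (1 - 2 * y 0 i) * \prod_(j | j != i) (y 0 j * (1 - y 0 j)).

Lemma cont_coord m (j : 'I_m) : continuous (fun y : 'rV[R]_m => y 0 j).
Proof. exact: coord_continuous. Qed.

Lemma cont_cutoff m : continuous (@cutoff m).
Proof.
by rewrite /cutoff; cont; exact: cont_coord.
Qed.

Lemma cont_partial_cutoff i : continuous (partial_cutoff i).
Proof.
by rewrite /partial_cutoff; cont; exact: cont_coord.
Qed.

Lemma has_partial_cutoff i : has_partial i (@cutoff n) (partial_cutoff i).
Proof.
move=> y.
pose P y := \prod_(j | j != i) (y 0 j * (1 - y 0 j)) : R.
have dP : is_derive y (delta_mx 0 i : Rn) P 0.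
  rewrite -[y]addr0 -[0](scale0r (delta_mx 0 i)); apply/(is_derive_slice P y (delta_mx 0 i)).
  apply: (eq_is_derive _ (is_derive_const (0 : R) (1 : R) (P y))) => h.
  by apply: eq_bigr => j ji; rewrite !mxE (negbTE ji) andbF mulr0 addr0.
have dc := @has_partial_coord R n i y.
have db := is_derive_mul dc (is_derive_sub (is_derive_const y (delta_mx 0 i : Rn) 1) dc).
have := is_derive_mul db dP; rewrite mulr0 addr0 mul1r sub0r mulrN1.
rewrite (_ : (1 - y 0 i - y 0 i) * P y = partial_cutoff i y); last by rewrite /partial_cutoff /P; congr (_ * _); ring.
by apply: eq_is_derive => z; rewrite /cutoff (bigD1 i).
Qed.

Lemma cutoff_ge0 m (y : 'rV[R]_m) : closed_cube y -> 0 <= cutoff y.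
Proof.
by move=> yc; apply: prodr_ge0 => j _; have /andP[? ?] := yc j; rewrite mulr_ge0// subr_ge0.
Qed.

Lemma cutoff_face (i : 'I_n) y : y 0 i = 0 \/ y 0 i = 1 -> cutoff y = 0.
Proof. by move=> yi; rewrite /cutoff (bigD1 i)//=; case: yi => ->; rewrite ?mul0r// subrr mulr0 mul0r. Qed.

(** Each coordinate contributes the integral 1/6 of t (1 - t) over [0, 1]. *)
Lemma avg_cutoff m : avg (@cutoff m) = 6^-1 ^+ m.
Proof.
elim: m => [|m IH].
  rewrite expr0 -[RHS](@avg_cst R 0); apply: eq_avg => y _.
  by rewrite /cutoff big_ord0.
rewrite (avg_cons1 (@cont_cutoff m.+1)).
transitivity (\int[@lebesgue_measure R]_(t in `[0%R, 1%R[) (6^-1 ^+ m * (t * (1 - t)))).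
  apply: eq_Rintegral => t _; rewrite -IH mulrC -avgZ; last exact: cont_cutoff.
  apply: eq_avg => y _; rewrite /cutoff big_ord_recl mxE unlift_none /=; congr (_ * _).
  by apply: eq_bigr => j _; rewrite mxE liftK.
pose F (t : R) := 6^-1 ^+ m * (t ^+ 2 / 2 - t ^+ 3 / 3).
transitivity (F 1 - F 0); last first.
  rewrite /F !expr0n/= !mul0r subrr mulr0 subr0 !expr1n exprS [RHS]mulrC; congr (_ * _).
  by field.
apply: FTC2_unit; first by cont.
move=> t; apply: is_derive_scale.
have i := @is_derive_idfun R t; have h2 := is_derive_mul i i; have h3 := is_derive_mul h2 i.
have := is_derive_sub (is_derive_mul h2 (is_derive_const t (1 : R) 2^-1)) (is_derive_mul h3 (is_derive_const t (1 : R) 3^-1)).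
rewrite (_ : _ - _ = t * (1 - t)); last by field.
by apply: eq_is_derive => s; rewrite !exprS expr0 !mulr1 mulrA.
Qed.

Lemma avg_cutoff_gt0 : 0 < avg (@cutoff n).
Proof. by rewrite avg_cutoff exprn_gt0// invr_gt0. Qed.

(** Convolution of f with the weight w rescaled to size delta. *)
Definition mollify w delta f x : R := avg (fun y => f (x + delta *: y) * w y).

Lemma cont_dilate delta : continuous (fun p : Rn * Rn => p.1 + delta *: p.2 : Rn).
Proof. by cont; [exact: cont_fst|exact: cont_snd]. Qed.

Lemma cont_mollify_integrand w delta f : continuous w -> continuous f ->
  continuous (fun p : Rn * Rn => f (p.1 + delta *: p.2) * w p.2).
Proof.
move=> cw cf; have := cont_comp (@cont_dilate delta) cf.
by have := cont_comp (@cont_snd Rn Rn) cw => ? ?; cont.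
Qed.

Lemma cont_slice (F : Rn * Rn -> R) x : continuous F -> continuous (fun y => F (x, y)).
Proof. exact: (cont_comp (cont_pair (@cont_cst _ _ x) (@cont_id _))). Qed.

Lemma cont_mollify w delta f : continuous w -> continuous f -> continuous (mollify w delta f).
Proof.
move=> cw cf.
exact: (avg_continuous (F := fun x y => f (x + delta *: y) * w y) (cont_mollify_integrand cw cf)).
Qed.

Lemma periodic_mollify w delta f : Defs.periodic f -> Defs.periodic (mollify w delta f).
Proof. by move=> pf x z; apply: eq_avg => y _; rewrite addrAC pf. Qed.

(** Young's inequality for the L1 norm: exchange the two averages, then use
    translation invariance. *)
Lemma avg_mollify_le w delta f : continuous w -> continuous f -> Defs.periodic f ->
  avg (fun x => `|mollify w delta f x|) <= avg (fun y => `|w y|) * avg (fun x => `|f x|).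
Proof.
move=> cw cf pf.
have cF := @cont_mollify_integrand w delta f cw cf.
have cFn := cont_norm cF.
apply: (@le_trans _ _ (avg (fun x => avg (fun y => `|f (x + delta *: y) * w y|)))).
  apply: avg_le; first by have ? := @cont_mollify w delta f cw cf; cont.
    exact: (avg_continuous (F := fun x y => `|f (x + delta *: y) * w y|) cFn).
  by move=> x _; apply: le_norm_avg; exact: (cont_slice cF).
rewrite (avg_swap cFn)/=.
have cfn : continuous (fun x => `|f x|) by cont.
have pfn : Defs.periodic (fun x => `|f x|) by exact: periodic_norm.
rewrite [leRHS]mulrC -avgZ; last by cont.
rewrite le_eqVlt; apply/orP; left; apply/eqP/eq_avg => y _.
under eq_avg do rewrite normrM mulrC.
rewrite avgZ; last exact: (cont_shift cfn).
by rewrite mulrC (avg_shift (delta *: y) cfn pfn).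
Qed.

Lemma avg_mollify w delta f : continuous w -> continuous f -> Defs.periodic f ->
  avg (mollify w delta f) = avg w * avg f.
Proof.
move=> cw cf pf; rewrite /mollify (avg_swap (@cont_mollify_integrand w delta f cw cf))/=.
rewrite [RHS]mulrC -avgZ//; apply: eq_avg => y _.
under eq_avg do rewrite mulrC.
by rewrite avgZ ?(avg_shift (delta *: y) cf pf) 1?mulrC//; exact: (cont_shift cf).
Qed.

Lemma has_partial_mollify w delta f g j : continuous w -> continuous f -> continuous g ->
  has_partial j f g -> has_partial j (mollify w delta f) (mollify w delta g).
Proof.
move=> cw cf cg fg x.
rewrite -{1}[x]addr0 -[0](scale0r (delta_mx 0 j)).
apply/(is_derive_slice (mollify w delta f) x (delta_mx 0 j)).
pose F (t : R) y := f (x + t *: delta_mx 0 j + delta *: y) * w y.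
pose dF (t : R) y := g (x + t *: delta_mx 0 j + delta *: y) * w y.
have -> : mollify w delta g x = avg (dF 0) by apply: eq_avg => y _; rewrite /dF scale0r addr0.
have cdF : continuous (fun p : R * Rn => dF p.1 p.2).
  have cl : continuous (fun p : R * Rn => x + p.1 *: delta_mx 0 j + delta *: p.2 : Rn).
    by cont; [exact: cont_fst|exact: cont_snd].
  have := cont_comp cl cg; have := cont_comp (@cont_snd R Rn) cw => ? ?.
  by rewrite /dF; cont.
apply: (@is_derive_avg R n F dF 0 1) => //.
- move=> t _; rewrite /F.
  by have := cont_slice (x := (x + t *: delta_mx 0 j)) (@cont_mollify_integrand w delta f cw cf).
- rewrite /dF.
  by have := cont_slice (x := (x + 0 *: delta_mx 0 j)) (@cont_mollify_integrand w delta g cw cg).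
- move=> t y _; have := fg (x + delta *: y + t *: delta_mx 0 j) => /is_derive_slice d.
  have := is_derive_mul d (is_derive_const t (1 : R) (w y)); rewrite mulr0 addr0 addrAC.
  by apply: eq_is_derive => s; rewrite /F addrAC.
- move=> y _ e e0; have /cvgrPdist_lt/(_ e e0) := cdF (0, y).
  rewrite /= => -[[P Q] /= [Pt Qx] PQ]; exists (Q, P) => //= -[x' s] [/= Qx' Ps].
  by rewrite distrC; exact: (PQ (s, x')).
Qed.

(** Integration by parts moves the derivative onto the cutoff, at the price of a
    factor 1 / delta. *)
Lemma mollify_partial delta f g i x : delta != 0 -> continuous f -> continuous g ->
  has_partial i f g ->
  mollify (@cutoff n) delta g x = - delta^-1 * mollify (partial_cutoff i) delta f x.
Proof.
move=> d0 cf cg fg.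
have cb := @cont_cutoff n; have cpb := @cont_partial_cutoff i.
have c1 := cont_slice (x := x) (@cont_mollify_integrand (@cutoff n) delta g cb cg).
have c2 := cont_slice (x := x) (@cont_mollify_integrand (partial_cutoff i) delta f cpb cf).
have c3 := cont_slice (x := x) (@cont_mollify_integrand (@cutoff n) delta f cb cf).
have : delta * mollify (@cutoff n) delta g x + mollify (partial_cutoff i) delta f x = 0.
  rewrite /mollify -avgZ// -avgD//; last by cont.
  apply: (avg_derive0 (i := i) c3); first by cont.
    move=> y; rewrite mulrA.
    have df : is_derive y (delta_mx 0 i : Rn) (fun y => f (x + delta *: y)) (delta * g (x + delta *: y)).
      rewrite -{1}[y]addr0 -[0](scale0r (delta_mx 0 i)).
      apply/(is_derive_slice (fun y => f (x + delta *: y)) y (delta_mx 0 i)).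
      have dl : is_derive (delta * 0) (1 : R) (fun h => f (x + delta *: y + h *: delta_mx 0 i)) (g (x + delta *: y + (delta * 0) *: delta_mx 0 i)).
        apply/(is_derive_slice f _ (delta_mx 0 i)); exact: fg.
      have := @is_derive_compose R _ _ (fun h : R => delta * h) 0 1 _ _ dl (is_derive_scale delta (@is_derive_idfun R 0)).
      rewrite mulr0 scale0r addr0 mulr1 mulrC; apply: eq_is_derive => h.
      by rewrite scalerDr scalerA addrA.
    exact: is_derive_mul df (has_partial_cutoff i y).
  move=> y yi; rewrite !(cutoff_face (i := i)) ?mulr0//; first by left.
  by right; rewrite !mxE yi !eqxx add0r.
move=> /eqP; rewrite addr_eq0 => /eqP E; apply: (mulfI d0).
by rewrite E mulrA mulrN divff// mulN1r.
Qed.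

Section gradient.
Variables (f : Rn -> R) (df : 'I_n -> Rn -> R) (delta : R).
Hypotheses (cf : continuous f) (pf : Defs.periodic f).
Hypotheses (cdf : forall j, continuous (df j)) (fdf : forall j, has_partial j f (df j)).
Hypothesis delta0 : 0 < delta.

(** The mollified function is an average of translates by at most delta in each
    coordinate. *)
Lemma mollify_dist :
  avg (fun x => `|mollify (@cutoff n) delta f x - avg (@cutoff n) * f x|) <=
  avg (@cutoff n) * (delta * \sum_j avg (fun x => `|df j x|)).
Proof.
have cb := @cont_cutoff n.
have cF := @cont_mollify_integrand (@cutoff n) delta f cb cf.
have cf1 := cont_comp (@cont_fst Rn Rn) cf.
have cb2 := cont_comp (@cont_snd Rn Rn) cb.
pose G p := `|(f (p.1 + delta *: p.2) - f p.1) * cutoff p.2|.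
have cfd := cont_comp (@cont_dilate delta) cf.
have cG : continuous G by rewrite /G; cont.
apply: (@le_trans _ _ (avg (fun x => avg (fun y => G (x, y))))).
  apply: avg_le; first by have ? := @cont_mollify (@cutoff n) delta f cb cf; cont.
    exact: (avg_continuous (F := fun x y => G (x, y)) cG).
  move=> x _; have c1 := cont_slice (x := x) cF.
  rewrite mulrC -avgZ// -avgB//; last by cont.
  apply: le_trans (le_norm_avg _) _; first by cont.
  by rewrite le_eqVlt; apply/orP; left; apply/eqP/eq_avg => y _; rewrite /G/= mulrBl.
rewrite (avg_swap cG) [leRHS]mulrC -avgZ//; apply: avg_le.
- have csw : continuous (fun p : Rn * Rn => (p.2, p.1)).
    by apply: cont_pair; [exact: cont_snd|exact: cont_fst].
  exact: (avg_continuous (F := fun y x => G (x, y)) (cont_comp csw cG)).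
- by cont.
move=> y yc; have by0 := cutoff_ge0 yc.
apply: (@le_trans _ _ (cutoff y * avg (fun x => `|f (x + delta *: y) - f x|))).
  rewrite -avgZ; last by have ? := cont_shift (v := delta *: y) cf; cont.
  by rewrite le_eqVlt; apply/orP; left; apply/eqP/eq_avg => x _; rewrite /G/= normrM mulrC (ger0_norm by0).
rewrite mulrC ler_wpM2r//; apply: le_trans (avg_shift_le cf pf cdf fdf _) _.
rewrite mulr_sumr; apply: ler_sum => j _; rewrite ler_wpM2r//; first exact: avg_ge0.
have /andP[y0 y1] := yc j.
by rewrite mxE normrM (ger0_norm (ltW delta0)) (ger0_norm y0) ler_piMr// ltW.
Qed.

End gradient.

(** If lam times the gradient of kap is a force plus the divergence of a tensor,
    then mollifying trades the divergence for a factor 1 / delta, so that lam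
    times the L1 norm of the gradient of the mollified kap is controlled by L1
    norms of the force and of the tensor. The Poincare inequality for the
    mollified function bounds this gradient below by the oscillation of kap, up
    to the mollification error delta times the L1 norm of the gradient. *)
Lemma multiplier_bound (kap : Rn -> R) (dkap a : 'I_n -> Rn -> R)
    (T dT : 'I_n -> 'I_n -> Rn -> R) (lam delta : R) : 0 < delta ->
  continuous kap -> Defs.periodic kap ->
  (forall j, continuous (dkap j)) -> (forall j, has_partial j kap (dkap j)) ->
  (forall j, continuous (a j)) -> (forall j, Defs.periodic (a j)) ->
  (forall i j, continuous (T i j)) -> (forall i j, Defs.periodic (T i j)) ->
  (forall i j, continuous (dT i j)) -> (forall i j, has_partial i (T i j) (dT i j)) ->
  (forall j x, lam * dkap j x = a j x + \sum_i dT i j x) ->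
  `|lam| * (avg (@cutoff n) * (avg (fun x => `|kap x - avg kap|)
                 - delta * \sum_j avg (fun x => `|dkap j x|))) <=
  \sum_j (avg (@cutoff n) * avg (fun x => `|a j x|) +
     delta^-1 * \sum_i avg (fun x => `|partial_cutoff i x|) * avg (fun x => `|T i j x|)).
Proof.
move=> d0 ck pk cdk kdk ca pa cT pT cdT TdT lamE.
have cb := @cont_cutoff n.
set rb := avg (@cutoff n); have rb0 : 0 <= rb by exact/ltW/avg_cutoff_gt0.
set u := mollify (@cutoff n) delta kap.
have cu : continuous u by exact: cont_mollify.
pose du j := mollify (@cutoff n) delta (dkap j).
have cdu j : continuous (du j) by exact: cont_mollify.
have pu : Defs.periodic u by exact: periodic_mollify.
have udu j : has_partial j u (du j) by exact: has_partial_mollify.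
have avgu : avg u = rb * avg kap by exact: avg_mollify.
have P := poincare cu pu cdu udu.
have D := mollify_dist ck pk cdk kdk d0; rewrite -/u -/rb in D.
have step : rb * (avg (fun x => `|kap x - avg kap|)
                 - delta * \sum_j avg (fun x => `|dkap j x|)) <= \sum_j avg (fun x => `|du j x|).
  rewrite mulrBr lerBlDr; apply: le_trans (lerD P D).
  rewrite -avgZ; last by cont.
  rewrite -avgD; [|by cont..].
  apply: avg_le; [by cont..|] => x _.
  rewrite -{1}(ger0_norm rb0) -normrM avgu mulrBr [leRHS]addrC (distrC (u x) (rb * kap x)).
  exact: ler_distD.
apply: le_trans (ler_wpM2l (normr_ge0 lam) step) _.
rewrite mulr_sumr; apply: ler_sum => j _.
have duE x : lam * du j x = mollify (@cutoff n) delta (a j) x + \sum_i mollify (@cutoff n) delta (dT i j) x.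
  have c1 g : continuous g -> continuous (fun y => g (x + delta *: y) * cutoff y).
    by move=> cg; have := cont_slice (x := x) (@cont_mollify_integrand (@cutoff n) delta g cb cg).
  rewrite /du /mollify -avg_sum; last by move=> i; exact: (c1 _ (@cdT i j)).
  rewrite -avgZ; last exact: (c1 _ (@cdk j)).
  rewrite -avgD; last 2 first.
  - exact: (c1 _ (@ca j)).
  - by apply: cont_sum => i _; exact: (c1 _ (@cdT i j)).
  by apply: eq_avg => y _; rewrite mulrA lamE mulrDl mulr_suml.
have cnu : continuous (fun x => `|du j x|) by exact: (cont_norm (@cdu j)).
have cnT i : continuous (fun x => `|mollify (@cutoff n) delta (dT i j) x|).
  by apply: cont_norm; exact: cont_mollify.
have cna : continuous (fun x => `|mollify (@cutoff n) delta (a j) x|).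
  by apply: cont_norm; exact: cont_mollify.
have csT : continuous (fun x => \sum_i `|mollify (@cutoff n) delta (dT i j) x|).
  by apply: cont_sum => i _; exact: cnT.
rewrite -[leLHS](avgZ _ cnu).
apply: (@le_trans _ _ (avg (fun x => `|mollify (@cutoff n) delta (a j) x| + \sum_i `|mollify (@cutoff n) delta (dT i j) x|))).
  apply: avg_le; [exact: contM (@cont_cst _ _ _) cnu|exact: contD cna csT|] => x _.
  rewrite -normrM duE; apply: le_trans (ler_normD _ _) _; rewrite lerD2l.
  exact: ler_norm_sum.
rewrite (avgD cna csT) (avg_sum _ cnT).
apply: lerD.
  apply: le_trans (avg_mollify_le _ cb (ca j) (pa j)) _.
  rewrite ler_wpM2r//; first exact: avg_ge0.
  by apply: avg_le; [by cont..|] => y yc; rewrite ger0_norm// cutoff_ge0.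
rewrite mulr_sumr; apply: ler_sum => i _.
have cpb := @cont_partial_cutoff i.
rewrite (_ : (fun x => _) = (fun x => delta^-1 * `|mollify (partial_cutoff i) delta (T i j) x|)); last first.
  apply/funext => x; rewrite (mollify_partial _ (lt0r_neq0 d0) (cT i j) (cdT i j) (TdT i j)).
  by have dv0 : 0 <= delta^-1; rewrite ?invr_ge0 ?ltW// normrM normrN (ger0_norm dv0).
have ? : continuous (mollify (partial_cutoff i) delta (T i j)) by exact: cont_mollify.
rewrite avgZ; last by cont.
by rewrite ler_pM2l ?invr_gt0//; exact: avg_mollify_le.
Qed.

End mollifier.

(** * The double well *)
Section double_well.
Context {R : realType}.
Implicit Types s t : R.

Lemma sqrt_2W s : Num.sqrt (2 * W s) = `|1 - s ^+ 2|.
Proof. by rewrite /W mulrC divfK ?sqrtr_sqr// pnatr_eq0. Qed.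

Lemma W_ge0 s : 0 <= W s.
Proof. by rewrite /W divr_ge0// sqr_ge0. Qed.

Lemma is_derive_W s : is_derive s (1 : R) W (- (2 * s * (1 - s ^+ 2))).
Proof.
have i := @is_derive_idfun R s.
have := is_derive_mul (is_derive_sqr (is_derive_sub (is_derive_const s (1 : R) 1) (is_derive_sqr i))) (is_derive_const s (1 : R) 2^-1).
by congr is_derive; field.
Qed.

Lemma derive1_W s : derive1 W s = - (2 * s * (1 - s ^+ 2)).
Proof. by rewrite derive1E; case: (is_derive_W s). Qed.

Lemma cont_W : continuous (@W R).
Proof. by rewrite /W; cont. Qed.

Lemma cont_sqrt_2W : continuous (fun s => Num.sqrt (2 * W s)).
Proof.
apply: (eq_cont (f := fun s => `|1 - s ^+ 2|)) => [s|]; first by rewrite sqrt_2W.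
by cont.
Qed.

Lemma is_derive_k s : is_derive s (1 : R) (@k R) `|1 - s ^+ 2|.
Proof. by rewrite -sqrt_2W; apply: is_derive_oriented_integral; exact: cont_sqrt_2W. Qed.

Lemma cont_k : continuous (@k R).
Proof. by move=> s; apply/differentiable_continuous/derivable1_diffP; case: (is_derive_k s). Qed.

Lemma k_at0 : k 0 = 0 :> R.
Proof. by rewrite /k /oriented_integral lexx set_itv1 Rintegral_set1. Qed.

Lemma kN s : k (- s) = - k s.
Proof.
have d t : is_derive t (1 : R) (fun t => k (- t) + k t) 0.
  have := is_derive_add (is_derive_compose (is_derive_k (- t)) (is_derive_opp (@is_derive_idfun R t))) (is_derive_k t).
  by rewrite sqrrN mulrN1 addNr.
have := is_derive_0_is_cst s 0 d; rewrite /= oppr0 k_at0 addr0 => /eqP.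
by rewrite addr_eq0 => /eqP.
Qed.

Lemma k_nondecreasing s t : s <= t -> k s <= k t.
Proof.
move=> st; have [c _] := @mean_value R _ (@k R) _ s 1 (t - s) is_derive_k.
rewrite -[(t - s) *: 1]/((t - s) * 1) mulr1 subrKC => E.
by rewrite -subr_ge0 E mulr_ge0// subr_ge0.
Qed.

Lemma k_unit s : 0 <= s <= 1 -> k s = s - s ^+ 3 / 3.
Proof.
move=> /andP[s0 s1]; move: s0; rewrite le_eqVlt => /predU1P[<-|s0].
  by rewrite k_at0 expr0n/= mul0r subr0.
rewrite /k /oriented_integral (ltW s0).
transitivity (\int[@lebesgue_measure R]_(r in `[0, s]) (1 - r ^+ 2)).
  apply: eq_Rintegral => r; rewrite inE/= in_itv/= => /andP[r0 rs].
  by rewrite sqrt_2W ger0_norm// subr_ge0 expr_le1// (le_trans rs).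
have cf : continuous (fun r : R => 1 - r ^+ 2) by cont.
have d (r : R) : is_derive r (1 : R) (fun r => r - r ^+ 3 / 3) (1 - r ^+ 2).
  have i := @is_derive_idfun R r.
  have := is_derive_sub i (is_derive_mul (is_derive_mul i (is_derive_sqr i)) (is_derive_const r (1 : R) 3^-1)).
  rewrite (_ : _ - _ = 1 - r ^+ 2); last by field.
  by apply: eq_is_derive => t; rewrite [in RHS]exprS.
by rewrite (FTC2_closed s0 cf d) expr0n/= mul0r !subr0.
Qed.

(** For s in [0, 1] the difference factors as (1 - s) (s^2 + 4 s + 1) / 3, for
    larger s it follows from monotonicity, for negative s from oddness. The
    deficit of |k| below 2/3 is thus controlled by the transition layer, also
    where |s| > 1. *)
Lemma k_ge s : 2 / 3 - `|1 - s ^+ 2| <= `|k s|.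
Proof.
wlog s0 : s / 0 <= s.
  move=> H; case: (leP 0 s) => [|/ltW s0]; first exact: H.
  by have := H (- s); rewrite oppr_ge0 sqrrN kN normrN; exact.
have [s1|/ltW s1] := leP s 1.
  rewrite k_unit ?s0// ger0_norm; last by rewrite subr_ge0 expr_le1.
  apply: le_trans (ler_norm _); rewrite -subr_ge0.
  rewrite (_ : _ - _ = (1 - s) * (s ^+ 2 + 4 * s + 1) / 3); last by field.
  by rewrite divr_ge0// mulr_ge0 ?subr_ge0// !addr_ge0// ?sqr_ge0// mulr_ge0.
have k1 := k_nondecreasing s1; rewrite k_unit ?lexx ?ler01// expr1n in k1.
have n0 := normr_ge0 (1 - s ^+ 2); have := ler_norm (k s).
by lra.
Qed.

Lemma sigmaE : sigma = 4 / 3 :> R.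
Proof.
rewrite /sigma /oriented_integral; case: ifPn => [_|]; last by rewrite -ltNge; lra.
have d (t : R) : is_derive t (1 : R) (@k R) (Num.sqrt (2 * W t)).
  by rewrite sqrt_2W; exact: is_derive_k.
have lt11 : (- 1 : R) < 1 by lra.
rewrite (FTC2_closed lt11 cont_sqrt_2W d) kN k_unit ?lexx ?ler01// expr1n.
by field.
Qed.

End double_well.

(** * The Cauchy-Schwarz inequality for averages *)
Section cauchy_schwarz.
Context {R : realType} {n : nat}.
Local Notation Rn := 'rV[R]_n.

(** Nonnegativity of the quadratic polynomial t -> avg ((f - t g)^2). *)
Lemma avg_cauchy_schwarz (f g : Rn -> R) : continuous f -> continuous g ->
  (avg (fun x => f x * g x)) ^+ 2 <= avg (fun x => f x ^+ 2) * avg (fun x => g x ^+ 2).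
Proof.
move=> cf cg; set b := avg (fun x => f x * g x); set a := avg (fun x => f x ^+ 2).
set c := avg (fun x => g x ^+ 2).
have a0 : 0 <= a by apply: avg_ge0 => x; exact: sqr_ge0.
have c0 : 0 <= c by apply: avg_ge0 => x; exact: sqr_ge0.
have H t : 0 <= a - 2 * t * b + t ^+ 2 * c.
  rewrite -avgZ; last by cont.
  rewrite -avgZ; last by cont.
  rewrite -avgB; [|by cont..].
  rewrite -avgD; [|by cont..].
  apply: avg_ge0 => x; rewrite (_ : _ + _ = (f x - t * g x) ^+ 2) ?sqr_ge0//; ring.
have [c00|cn0] := eqVneq c 0.
  rewrite c00 mulr0; have := H ((a + 1) / b / 2); rewrite c00 mulr0 addr0.
  have [->|b0] := eqVneq b 0; first by rewrite expr0n.
  rewrite (_ : 2 * _ * b = a + 1); last by field.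
  lra.
have cp : 0 < c by rewrite lt0r cn0.
have := H (b / c); rewrite (_ : _ + _ = (a * c - b ^+ 2) / c); last by field.
by rewrite pmulr_lge0 ?invr_gt0// subr_ge0.
Qed.

Lemma sqr_avg_le (f : Rn -> R) : continuous f ->
  (avg f) ^+ 2 <= avg (fun x => f x ^+ 2).
Proof.
move=> cf; have := avg_cauchy_schwarz cf (@cont_cst _ _ (1 : R)).
under eq_avg do rewrite mulr1.
by rewrite expr1n avg_cst mulr1.
Qed.

End cauchy_schwarz.

(** * Symmetry of second derivatives *)
Section second_derivatives.
Context {R : realType} {n : nat}.
Local Notation Rn := 'rV[R]_n.

Lemma near_plane (g : Rn -> R) (x v w : Rn) (e : R) : continuous g -> 0 < e ->
  exists2 d : R, 0 < d &
    forall a b, `|a| <= d -> `|b| <= d -> `|g (x + a *: v + b *: w) - g x| < e.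
Proof.
move=> cg e0.
have cl : continuous (fun p : R * R => x + p.1 *: v + p.2 *: w : Rn).
  by cont; [exact: cont_fst|exact: cont_snd].
have /cvgrPdist_lt/(_ e e0)/nbhs_ballP[d /= d0 H] := (cont_comp cl cg : continuous _) (0, 0).
exists (d / 2); first by rewrite divr_gt0.
move=> a b ad bd.
have half t : `|t| <= d / 2 -> ball (0 : R) d t.
  by rewrite /ball/= sub0r normrN => /le_lt_trans; apply; rewrite ltr_pdivrMr// ltr_pMr// ltr1n.
have /= := H (a, b) (conj (half _ ad) (half _ bd)).
by rewrite distrC !scale0r !addr0.
Qed.

(** Two applications of the mean value theorem; the left-hand side is symmetric
    in i and j, which gives the equality of the mixed derivatives in the limit
    s -> 0. *)
Lemma second_difference (f fi fji : Rn -> R) (i j : 'I_n) (x : Rn) (s : R) :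
  has_partial i f fi -> has_partial j fi fji ->
  exists a b, [/\ `|a| <= `|s|, `|b| <= `|s| &
   f (x + s *: delta_mx 0 i + s *: delta_mx 0 j) - f (x + s *: delta_mx 0 i)
   - f (x + s *: delta_mx 0 j) + f x =
   s * (s * fji (x + a *: delta_mx 0 i + b *: delta_mx 0 j))].
Proof.
move=> dfi dfji.
pose G y := f (y + s *: delta_mx 0 j) - f y.
pose dG y := fi (y + s *: delta_mx 0 j) - fi y.
have dGG y : is_derive y (delta_mx 0 i : Rn) G (dG y).
  apply: is_derive_sub; last exact: dfi.
  rewrite -{1}[y]addr0 -[0](scale0r (delta_mx 0 i)).
  apply/(is_derive_slice (fun y => f (y + s *: delta_mx 0 j)) y (delta_mx 0 i)).
  have : is_derive 0 (1 : R) (fun h => f (y + s *: delta_mx 0 j + h *: delta_mx 0 i))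
    (fi (y + s *: delta_mx 0 j)).
    apply/(is_derive_slice f (y + s *: delta_mx 0 j) (delta_mx 0 i)).
    by rewrite scale0r addr0; exact: dfi.
  by apply: eq_is_derive => h; rewrite addrAC.
have [a as_ E] := @mean_value R _ G dG x (delta_mx 0 i) s dGG.
have [b bs E2] := @mean_value R _ fi fji (x + a *: delta_mx 0 i) (delta_mx 0 j) s dfji.
exists a, b; split => //; rewrite -E2 -/(dG _) -E /G.
by ring.
Qed.

Lemma schwarz (f fi fj fij fji : Rn -> R) (i j : 'I_n) :
  has_partial i f fi -> has_partial j f fj ->
  has_partial j fi fji -> has_partial i fj fij ->
  continuous fij -> continuous fji -> fij = fji.
Proof.
move=> dfi dfj dfji dfij cij cji; apply/funext => x.
apply/eqP; rewrite -subr_eq0 -normr_le0; apply/ler_addgt0Pr => e e0; rewrite add0r.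
have e2 : 0 < e / 2 by rewrite divr_gt0.
have [d1 d10 H1] := near_plane x (delta_mx 0 i) (delta_mx 0 j) cji e2.
have [d2 d20 H2] := near_plane x (delta_mx 0 j) (delta_mx 0 i) cij e2.
pose s := Num.min d1 d2.
have s0 : 0 < s by rewrite lt_min d10.
have [sd1 sd2] : s <= d1 /\ s <= d2 by rewrite /s !ge_min !lexx orbT.
have [a [b [as_ bs E]]] := second_difference x s dfi dfji.
have [a' [b' [as' bs' E']]] := second_difference x s dfj dfij.
rewrite (gtr0_norm s0) in as_ bs as' bs'.
have EE : fji (x + a *: delta_mx 0 i + b *: delta_mx 0 j) = fij (x + a' *: delta_mx 0 j + b' *: delta_mx 0 i).
  apply: (mulfI (lt0r_neq0 s0)); apply: (mulfI (lt0r_neq0 s0)); rewrite -E -E'.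
  by rewrite (addrAC x); ring.
have := H1 a b (le_trans as_ sd1) (le_trans bs sd1).
have := H2 a' b' (le_trans as' sd2) (le_trans bs' sd2).
rewrite EE => h1 h2.
rewrite -(subrKA (fij (x + a' *: delta_mx 0 j + b' *: delta_mx 0 i))).
by rewrite (le_trans (ler_normD _ _))// [leRHS]splitr lerD// ltW// distrC.
Qed.

End second_derivatives.

(** * Energy density and stress tensor *)
Section energy.
Context {R : realType} {n : nat}.
Local Notation Rn := 'rV[R]_n.
Implicit Types (u p : Rn -> R) (eps lam : R).

Lemma class_C2P u : class_C 2 setT u ->
  [/\ continuous u, forall j, continuous (partial j u),
      forall j, has_partial j u (partial j u),
      forall i j, continuous (partial i (partial j u)) &
      forall i j, has_partial i (partial j u) (partial i (partial j u))].
Proof.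
move=> [cu H]; split.
- by move=> x; exact: cu.
- by move=> j x; have [_ [c _]] := H j; exact: c.
- by move=> j x; have [d _] := H j; split; [exact: d|].
- by move=> i j x; have [_ [_ H2]] := H j; have [_ [c _]] := H2 i; exact: c.
- by move=> i j x; have [_ [_ H2]] := H j; have [d _] := H2 i; split; [exact: d|].
Qed.

Lemma sqr_enorm_grad u x : enorm (grad u x) ^+ 2 = \sum_i partial i u x ^+ 2.
Proof.
rewrite sqr_sqrtr; last by apply: sumr_ge0 => i _; exact: sqr_ge0.
by apply: eq_bigr => i _; rewrite mxE.
Qed.

Definition energy_density eps u x : R := eps * enorm (grad u x) ^+ 2 / 2 + W (u x) / eps.

Definition energy eps u : R := avg (energy_density eps u).

Lemma energy_densityE eps u x :
  energy_density eps u x = eps / 2 * (\sum_i partial i u x ^+ 2) + W (u x) / eps.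
Proof. by rewrite /energy_density sqr_enorm_grad mulrAC. Qed.

Lemma cont_energy_density eps u : class_C 2 setT u -> continuous (energy_density eps u).
Proof.
move=> /class_C2P[cu cu1 _ _ _].
apply: (eq_cont (fun x => esym (energy_densityE eps u x))).
have cWu := cont_comp cu (@cont_W R).
apply: contD; last by cont.
by apply: contM; [exact: cont_cst|apply: cont_sum => i _; apply: contX; exact: cu1].
Qed.

Section bounds.
Variables (eps : R) (u : Rn -> R).
Hypotheses (eps0 : 0 < eps) (C2u : class_C 2 setT u).

Lemma W_le_energy x : W (u x) <= eps * energy_density eps u x.
Proof.
rewrite energy_densityE mulrDr (mulrC eps (_ / eps)) divfK ?gt_eqF// lerDr.
by rewrite !mulr_ge0 ?invr_ge0 ?(ltW eps0)// sumr_ge0// => i _; exact: sqr_ge0.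
Qed.

Lemma energy_density_ge0 x : 0 <= energy_density eps u x.
Proof.
have := W_le_energy x; have := W_ge0 (u x) => a b.
by rewrite -(pmulr_rge0 _ eps0) (le_trans a b).
Qed.

Lemma sum_sqr_le_energy x : eps * (\sum_i partial i u x ^+ 2) <= 2 * energy_density eps u x.
Proof.
rewrite energy_densityE mulrDr (_ : 2 * (eps / 2 * _) = eps * \sum_i partial i u x ^+ 2); last by field.
by rewrite lerDl mulr_ge0// divr_ge0 ?W_ge0// ltW.
Qed.

Lemma sqr_le_energy j x : eps * partial j u x ^+ 2 <= 2 * energy_density eps u x.
Proof.
apply: le_trans (sum_sqr_le_energy x); rewrite ler_pM2l// (bigD1 j)//= lerDl.
by apply: sumr_ge0 => i _; exact: sqr_ge0.
Qed.

(** The Modica-Mortola inequality: 2 a b <= eps b^2 + a^2 / eps with a the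
    modulus of 1 - u^2 and b that of a derivative of u. *)
Lemma grad_k_le_energy j x :
  `| `|1 - u x ^+ 2| * partial j u x| <= energy_density eps u x.
Proof.
rewrite normrM normr_id; set a := `|_|; set b := `|_|.
have := sqr_le_energy j x; have := energy_densityE eps u x.
have b2 : partial j u x ^+ 2 = b ^+ 2 by rewrite /b real_normK ?num_real.
have a2 : W (u x) = a ^+ 2 / 2 by rewrite /W /a real_normK ?num_real.
have S : partial j u x ^+ 2 <= \sum_i partial i u x ^+ 2.
  by rewrite (bigD1 j)//= lerDl; apply: sumr_ge0 => i _; exact: sqr_ge0.
move=> -> _; rewrite a2; apply: (@le_trans _ _ (eps / 2 * b ^+ 2 + a ^+ 2 / 2 / eps)).
  rewrite -subr_ge0 (_ : _ - _ = (eps * b - a) ^+ 2 / (2 * eps)); last by field; rewrite gt_eqF.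
  by rewrite divr_ge0 ?sqr_ge0// mulr_ge0// ltW.
by rewrite lerD2r -b2 ler_pM2l ?divr_gt0.
Qed.

(** The energy-momentum tensor of the phase-field energy. *)
Definition stress i j x : R :=
  (i == j)%:R * energy_density eps u x - eps * (partial i u x * partial j u x).

Lemma stress_le i j x : `|stress i j x| <= 3 * energy_density eps u x.
Proof.
have e0 := energy_density_ge0 x.
have h : eps * `|partial i u x * partial j u x| <= 2 * energy_density eps u x.
  have hi := sqr_le_energy i x; have hj := sqr_le_energy j x.
  apply: (@le_trans _ _ ((eps * partial i u x ^+ 2 + eps * partial j u x ^+ 2) / 2)); last by lra.
  rewrite -mulrDr -mulrA ler_pM2l// normrM.
  rewrite -[X in _ <= (X + _) / 2](real_normK (num_real _)) -[X in _ <= (_ + X) / 2](real_normK (num_real _)).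
  set a := `|partial i u x|; set b := `|partial j u x|.
  rewrite -subr_ge0 (_ : _ - _ = (a - b) ^+ 2 / 2); last by field.
  by rewrite divr_ge0 ?sqr_ge0.
apply: le_trans (ler_normB _ _) _; rewrite normrM (normrM eps) (gtr0_norm eps0).
rewrite (ger0_norm e0) (_ : 3 = 1 + 2); last by ring.
rewrite mulrDl mul1r lerD// ler_piMl//.
by case: (i == j); rewrite ?normr1 ?normr0.
Qed.

Definition div_stress i j x : R :=
  (i == j)%:R * (eps * (\sum_l partial l u x * partial i (partial l u) x)
                 + derive1 W (u x) / eps * partial i u x)
  - eps * (partial i (partial i u) x * partial j u x + partial i u x * partial i (partial j u) x).

Lemma has_partial_stress i j : has_partial i (stress i j) (div_stress i j).
Proof.
move=> x; have [cu cu1 du cu2 du2] := class_C2P C2u.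
apply: is_derive_sub; last first.
  by apply: is_derive_scale; apply: is_derive_mul; [exact: du2|exact: du2].
apply: is_derive_scale; apply: (eq_is_derive (fun y => esym (energy_densityE eps u y))).
have dS : is_derive x (delta_mx 0 i : Rn) (fun y => \sum_l partial l u y ^+ 2)
    (\sum_l 2 * partial l u x * partial i (partial l u) x).
  by apply: is_derive_bigsum => l; apply: is_derive_sqr; exact: du2.
have dWu := is_derive_compose (is_derive_W (u x)) (du i x).
have dd := is_derive_add (is_derive_scale (eps / 2) dS) (is_derive_mul dWu (is_derive_const x (delta_mx 0 i : Rn) eps^-1)).
apply: (is_derive_eq dd); rewrite derive1_W mulr0 addr0; congr (_ + _); last by rewrite mulrAC.
under eq_bigr do rewrite -mulrA.
by rewrite -mulr_sumr mulrA divfK// pnatr_eq0.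
Qed.

Lemma cont_stress i j : continuous (stress i j).
Proof.
have [cu cu1 _ _ _] := class_C2P C2u; have ce := cont_energy_density (eps := eps) C2u.
exact: contD (contM (@cont_cst _ _ _) ce)
  (contN (contM (@cont_cst _ _ eps) (contM (cu1 i) (cu1 j)))).
Qed.

Lemma cont_div_stress i j : continuous (div_stress i j).
Proof.
have [cu cu1 du cu2 du2] := class_C2P C2u.
have cWu : continuous (fun x => derive1 W (u x)).
  by apply: (eq_cont (fun x => esym (derive1_W (u x)))); cont.
have cS : continuous (fun x => \sum_l partial l u x * partial i (partial l u) x).
  by apply: cont_sum => l _; exact: contM (cu1 l) (cu2 i l).
have c1 := contM (@cont_cst _ _ eps) cS.
have c2 := contM (contM cWu (@cont_cst _ _ eps^-1)) (cu1 i).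
have c3 := contD (contM (cu2 i i) (cu1 j)) (contM (cu1 i) (cu2 i j)).
exact: contD (contM (@cont_cst _ _ _) (contD c1 c2)) (contN (contM (@cont_cst _ _ eps) c3)).
Qed.

Let stress_algebra (a : 'I_n -> R) (h : 'I_n -> 'I_n -> R) (w : R) j :
  (forall i l, h i l = h l i) ->
  \sum_i ((i == j)%:R * (eps * (\sum_l a l * h i l) + w * a i)
          - eps * (h i i * a j + a i * h i j)) =
  - (eps * (\sum_i h i i) - w) * a j.
Proof.
move=> hC; rewrite sumrB (bigD1 j)//= eqxx mul1r.
rewrite (big1 _ (fun i => i != j)) ?addr0; last by move=> i /negbTE ->; rewrite mul0r.
rewrite -mulr_sumr big_split/= -mulr_suml.
have -> : \sum_i a i * h i j = \sum_l a l * h j l by apply: eq_bigr => l _; rewrite hC.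
by ring.
Qed.

(** The divergence of the stress tensor is the first variation of the energy
    times the gradient. The terms with mixed derivatives cancel because these
    are symmetric. *)
Lemma sum_div_stress j x : \sum_i div_stress i j x =
  - (eps * laplacian u x - derive1 W (u x) / eps) * partial j u x.
Proof.
have [cu cu1 du cu2 du2] := class_C2P C2u.
apply: (@stress_algebra (fun i => partial i u x) (fun i l => partial i (partial l u) x)) => i l.
by rewrite (schwarz (du l) (du i) (du2 i l) (du2 l i) (cu2 l i) (cu2 i l)).
Qed.

Lemma periodic_stress i j : Defs.periodic u -> Defs.periodic (stress i j).
Proof.
move=> pu; have [cu cu1 du cu2 du2] := class_C2P C2u.
have pu1 l : Defs.periodic (partial l u) by exact: periodic_partial pu (du l).
move=> x z; rewrite /stress !energy_densityE pu !pu1.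
by under eq_bigr do rewrite pu1.
Qed.

End bounds.

End energy.

(** * The bound on the multiplier at a fixed time *)
Section static_estimate.
Context {R : realType} {n : nat}.
Local Notation Rn := 'rV[R]_n.

Section fixed.
Variables (omega M eps lam : R) (u p : Rn -> R).
Hypotheses (omega0 : 0 < omega) (M0 : 0 < M) (eps01 : 0 < eps < 1).
Hypotheses (C2u : class_C 2 setT u) (pu : Defs.periodic u).
Hypothesis eq_p : forall x, eps * p x = eps * laplacian u x - derive1 W (u x) / eps
  + lam * Num.sqrt (2 * W (u x)).
Hypothesis energy_le : energy eps u <= M.
Hypothesis volume_le : `|avg (fun x => k (u x))| <= 2 / 3 - omega.

Let D := avg (fun x => eps * p x ^+ 2).
Let s := avg (fun x => `|1 - u x ^+ 2|).

Let eps0 : 0 < eps. Proof. by case/andP: eps01. Qed.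

Let cu : continuous u. Proof. by have [] := class_C2P C2u. Qed.
Let cu1 j : continuous (partial j u). Proof. by have [] := class_C2P C2u. Qed.
Let du j : has_partial j u (partial j u). Proof. by have [] := class_C2P C2u. Qed.
Let cu2 i j : continuous (partial i (partial j u)). Proof. by have [] := class_C2P C2u. Qed.
Let du2 i j : has_partial i (partial j u) (partial i (partial j u)).
Proof. by have [] := class_C2P C2u. Qed.

Let pu1 j : Defs.periodic (partial j u). Proof. exact: periodic_partial pu (du j). Qed.
Let pu2 i j : Defs.periodic (partial i (partial j u)).
Proof. exact: periodic_partial (@pu1 j) (du2 i j). Qed.

Let cW' : continuous (fun x => derive1 W (u x)).
Proof. by apply: (eq_cont (fun x => esym (derive1_W (u x)))); cont. Qed.

Let clap : continuous (laplacian u).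
Proof. by rewrite /laplacian; apply: cont_sum => i _; exact: cu2. Qed.

Let plap : Defs.periodic (laplacian u).
Proof. by move=> x z; apply: eq_bigr => i _; exact: (@pu2 i i x z). Qed.

Let cmod : continuous (fun x => `|1 - u x ^+ 2|). Proof. by cont. Qed.

Let pE x : p x = laplacian u x - derive1 W (u x) / eps / eps + lam * `|1 - u x ^+ 2| / eps.
Proof.
apply: (mulfI (lt0r_neq0 eps0)); rewrite eq_p sqrt_2W.
by field; rewrite gt_eqF.
Qed.

Let cp : continuous p.
Proof. by apply: (eq_cont (fun x => esym (pE x))); cont. Qed.

Let D_ge0 : 0 <= D. Proof. by apply: avg_ge0 => x; rewrite mulr_ge0 ?sqr_ge0// ltW. Qed.

Let cWu : continuous (fun x => W (u x)). Proof. exact: (cont_comp cu (@cont_W R)). Qed.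

Let avg_W_le : avg (fun x => W (u x)) <= eps * M.
Proof.
have ce := cont_energy_density (eps := eps) C2u.
apply: (@le_trans _ _ (avg (fun x => eps * energy_density eps u x))).
  apply: avg_le; [by []|by cont|] => x _; exact: W_le_energy.
by rewrite avgZ// ler_pM2l.
Qed.

Let sqr_avg_p_le : (avg (fun x => `|eps * p x|)) ^+ 2 <= D.
Proof.
apply: le_trans (sqr_avg_le _) _; first by cont.
apply: avg_le; [by cont..|] => x _.
rewrite real_normK ?num_real// exprMn ler_wpM2r ?sqr_ge0// expr2 ler_piMl// ltW//.
by case/andP: eps01.
Qed.

Let avg_laplacian : avg (laplacian u) = 0.
Proof.
rewrite /laplacian avg_sum; last by move=> i; exact: cu2.
by apply: big1 => i _; exact: (avg_partial0 (@cu1 i) (@cu2 i i) (@pu1 i) (@du2 i i)).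
Qed.

(** When the transition layer occupies a definite part of the torus, the equation
    tested with the constant 1 determines lam, the Laplacian having average 0.
    The potential energy W / eps is then at least of order 1 / eps, so the energy
    bound forces eps to be bounded below. *)
Lemma sqr_lambda_le_diffuse : omega / 2 <= s ->
  lam ^+ 2 <= 8 / omega ^+ 2 * D + 8 / omega ^+ 2 * (8 * M / omega ^+ 2 + 4 * M) ^+ 2.
Proof.
move=> os.
have s0 : 0 < s by apply: lt_le_trans os; rewrite divr_gt0.
have s2 : s ^+ 2 <= 2 * (eps * M).
  apply: le_trans (sqr_avg_le _) _; first by cont.
  apply: (@le_trans _ _ (avg (fun x => 2 * W (u x)))).
    apply: avg_le; [by cont..|] => x _; rewrite real_normK ?num_real// /W.
    by rewrite mulrC divfK// pnatr_eq0.
  by rewrite avgZ// ler_pM2l.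
(* The lower bound on eps: (omega / 2)^2 <= S^2 <= 2 eps M. *)
have inv_eps : eps^-1 <= 8 * M / omega ^+ 2.
  rewrite ler_pdivlMr ?exprn_gt0// mulrC ler_pdivrMr//.
  have : (omega / 2) ^+ 2 <= s ^+ 2 by rewrite ler_sqr// nnegrE ltW// divr_gt0.
  rewrite exprMn (_ : 2^-1 ^+ 2 = 4^-1); last by field.
  lra.
have cP : continuous (fun x => eps * p x) by cont.
have aW' : avg (fun x => `|derive1 W (u x)|) <= 1 + 4 * (eps * M).
  apply: (@le_trans _ _ (avg (fun x => 1 + 4 * W (u x)))).
    apply: avg_le; [by cont..|] => x _; rewrite derive1_W normrN !normrM /W.
    set a := u x; set b := `|1 - a ^+ 2|.
    have -> : (1 - a ^+ 2) ^+ 2 = b ^+ 2 by rewrite /b real_normK ?num_real.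
    have a1 : 2 * `|a| <= 1 + a ^+ 2.
      rewrite -(real_normK (num_real a)) -subr_ge0 (_ : _ - _ = (`|a| - 1) ^+ 2) ?sqr_ge0//; ring.
    have a2 : a ^+ 2 <= 1 + b by rewrite /b; have := ler_norm (- (1 - a ^+ 2)); rewrite normrN; lra.
    have b0 : 0 <= b by exact: normr_ge0.
    rewrite (ger0_norm (ler0n _ _)).
    apply: (@le_trans _ _ ((2 + b) * b)); first by rewrite ler_wpM2r//; lra.
    have := sqr_ge0 (b - 1); nra.
  rewrite avgD; [|by cont..].
  by rewrite avg_cst avgZ// lerD2l ler_pM2l.
have ident : lam * s = avg (fun x => eps * p x) + avg (fun x => derive1 W (u x)) / eps.
  rewrite -avgZ; last by cont.
  rewrite [X in _ + X]mulrC -avgZ; last by cont.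
  rewrite -avgD; [|by cont..].
  rewrite -[LHS]add0r -(mulr0 eps) -avg_laplacian -avgZ// -avgD; [|by cont..].
  by apply: eq_avg => x _; rewrite eq_p sqrt_2W; ring.
have X : `|lam| * s <= avg (fun x => `|eps * p x|) + (8 * M / omega ^+ 2 + 4 * M).
  rewrite -{1}(gtr0_norm s0) -normrM ident; apply: le_trans (ler_normD _ _) _.
  apply: lerD; first exact: le_norm_avg.
  have dv : 0 <= eps^-1 by rewrite invr_ge0 ltW.
  rewrite normrM (ger0_norm dv).
  rewrite ler_pdivrMr//; apply: le_trans (le_norm_avg cW') _.
  apply: le_trans aW' _.
  have -> : (8 * M / omega ^+ 2 + 4 * M) * eps = 8 * M / omega ^+ 2 * eps + 4 * (eps * M) by ring.
  by rewrite lerD2r -ler_pdivrMr// mul1r.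
set Y := 8 * M / omega ^+ 2 + 4 * M in X *.
set Z := avg (fun x => `|eps * p x|) in X.
have Z2 : Z ^+ 2 <= D := sqr_avg_p_le.
have Z0 : 0 <= Z by apply: avg_ge0 => x; exact: normr_ge0.
have Y0 : 0 <= Y by rewrite addr_ge0 ?divr_ge0 ?mulr_ge0 ?sqr_ge0// ltW.
have XX : `|lam| * (omega / 2) <= Z + Y by apply: le_trans X; rewrite ler_wpM2l.
have : (`|lam| * (omega / 2)) ^+ 2 <= (Z + Y) ^+ 2.
  have lo0 : 0 <= `|lam| * (omega / 2) by rewrite mulr_ge0// divr_ge0// ltW.
  by rewrite ler_sqr ?nnegrE// addr_ge0.
rewrite exprMn real_normK ?num_real// exprMn (_ : 2^-1 ^+ 2 = 4^-1); last by field.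
move=> h; rewrite -mulrDr mulrAC ler_pdivlMr ?exprn_gt0//.
have := sqr_ge0 (Z - Y); nra.
Qed.

(** When the transition layer is small, |k u| is close to 2/3 in mean while its
    mean is at most 2/3 - omega in modulus, so k u oscillates by at least
    omega / 2. The equation multiplied by the gradient of u has the form required
    by multiplier_bound, with the stress tensor, and delta is taken so small that
    the mollification error, at most delta * n * M, uses up only half of this
    oscillation. *)
Lemma sqr_lambda_le_sharp (rb := avg (@cutoff R n))
   (c := \sum_i avg (fun x => `|@partial_cutoff R n i x|))
   (delta := omega / (4 * (n%:R * M + 1))) : s <= omega / 2 ->
  lam ^+ 2 <= 2 * (4 / (rb * omega) * (rb * n%:R)) ^+ 2 * (2 * M) * D
     + 2 * (4 / (rb * omega) * (n%:R * (delta^-1 * (3 * M * c)))) ^+ 2.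
Proof.
move=> so; have rb0 : 0 < rb by exact: avg_cutoff_gt0.
have nM : 0 < n%:R * M + 1 by rewrite ltr_wpDl// mulr_ge0// ltW.
have delta0 : 0 < delta by rewrite divr_gt0// mulr_gt0.
pose kap x := k (u x); pose dkap j x := `|1 - u x ^+ 2| * partial j u x.
have ck : continuous kap by exact: (cont_comp cu (@cont_k R)).
have cdk j : continuous (dkap j) by exact: contM cmod (@cu1 j).
have dk j : has_partial j kap (dkap j).
  by move=> x; exact: is_derive_compose (is_derive_k (u x)) (du j x).
pose a j x := eps * p x * partial j u x.
have pp : Defs.periodic p.
  by move=> x z; rewrite !pE pu plap.
have ca j : continuous (a j) by apply: contM; [exact: contM (@cont_cst _ _ _) cp|exact: cu1].
have pa j : Defs.periodic (a j) by move=> x z; rewrite /a pp pu1.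
have pk : Defs.periodic kap by move=> x z; rewrite /kap pu.
have eqs j x : lam * dkap j x = a j x + \sum_i div_stress eps u i j x.
  by rewrite sum_div_stress// /a /dkap eq_p sqrt_2W; ring.
have ce := cont_energy_density (eps := eps) C2u.
have main := multiplier_bound delta0 ck pk cdk dk ca pa (cont_stress (eps := eps) C2u)
  (fun i j => @periodic_stress R n eps u C2u i j pu) (cont_div_stress (eps := eps) C2u)
  (has_partial_stress eps C2u) eqs.
rewrite -/rb in main.
have grad_le : \sum_j avg (fun x => `|dkap j x|) <= n%:R * M.
  apply: (@le_trans _ _ (\sum_(j < n) M)); last by rewrite sumr_const card_ord mulr_natl.
  apply: ler_sum => j _; apply: le_trans energy_le.
  apply: avg_le; [exact: (cont_norm (@cdk j))|by []|] => x _; exact: grad_k_le_energy.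
have osc : omega / 2 <= avg (fun x => `|kap x - avg kap|).
  apply: (@le_trans _ _ (avg (fun x => (2 / 3 - `|1 - u x ^+ 2|) - (2 / 3 - omega)))).
    rewrite avgB; [|by cont..].
    rewrite avgB; [|by cont..].
    by rewrite !avg_cst; move: so; rewrite /s; lra.
  apply: avg_le; [by cont..|] => x _.
  have := k_ge (u x); rewrite -/(kap x) => h1.
  have := ler_distD 0 (kap x) (avg kap); have := lerB_dist (kap x) (avg kap).
  have := volume_le; rewrite -/kap; lra.
have delta_grad : delta * \sum_j avg (fun x => `|dkap j x|) <= omega / 4.
  apply: (@le_trans _ _ (delta * (n%:R * M + 1))).
    by rewrite ler_pM2l//; apply: le_trans grad_le _; rewrite lerDl.
  by rewrite le_eqVlt; apply/orP; left; apply/eqP; rewrite /delta; field; rewrite gt_eqF.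
have left_ge : `|lam| * (rb * (omega / 4)) <= `|lam| * (rb * (avg (fun x => `|kap x - avg kap|)
    - delta * \sum_j avg (fun x => `|dkap j x|))).
  by rewrite ler_wpM2l// ler_pM2l//; lra.
(* The force is controlled by the dissipation and the energy. *)
have a_le j : avg (fun x => `|a j x|) <= Num.sqrt (2 * M * D).
  rewrite -ler_sqr ?nnegrE ?sqrtr_ge0//; last by apply: avg_ge0 => x; exact: normr_ge0.
  rewrite sqr_sqrtr; last by rewrite !mulr_ge0// ltW.
  have := avg_cauchy_schwarz (cont_norm (contM (@cont_cst _ _ eps) cp)) (cont_norm (@cu1 j)).
  under eq_avg do rewrite -normrM -/(a j _).
  move=> /le_trans; apply.
  rewrite (_ : avg _ = eps * D); last first.
    rewrite -avgZ; last by cont.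
    by apply: eq_avg => x _; rewrite real_normK ?num_real//; ring.
  rewrite [leLHS](_ : _ = avg (fun x => `|partial j u x| ^+ 2) * eps * D); last by ring.
  rewrite ler_wpM2r//.
  have -> : avg (fun x => `|partial j u x| ^+ 2) * eps = avg (fun x => eps * partial j u x ^+ 2).
    have ? := @cu1 j; rewrite mulrC -avgZ; last by cont.
    by apply: eq_avg => x _; rewrite real_normK ?num_real.
  apply: (@le_trans _ _ (avg (fun x => 2 * energy_density eps u x))).
    have ? := @cu1 j; apply: avg_le; [by cont..|] => x _; exact: sqr_le_energy.
  by rewrite avgZ// ler_pM2l.
have T_le i j : avg (fun x => `|stress eps u i j x|) <= 3 * M.
  apply: (@le_trans _ _ (avg (fun x => 3 * energy_density eps u x))).
    have cs : continuous (stress eps u i j) by exact: cont_stress.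
    apply: avg_le; [exact: (cont_norm cs)|by cont|] => x _.
    exact: stress_le.
  by rewrite avgZ// ler_pM2l.
set X := Num.sqrt (2 * M * D) in a_le.
have right_le : `|lam| * (rb * (omega / 4)) <= n%:R * (rb * X + delta^-1 * (3 * M * c)).
  apply: le_trans left_ge _; apply: le_trans main _.
  apply: (@le_trans _ _ (\sum_(j < n) (rb * X + delta^-1 * (3 * M * c)))); last first.
    by rewrite sumr_const card_ord [leRHS]mulr_natl.
  apply: ler_sum => j _; apply: lerD; first by rewrite ler_pM2l.
  rewrite ler_pM2l ?invr_gt0// mulrC /c mulr_suml; apply: ler_sum => i _.
  by rewrite ler_wpM2l//; apply: avg_ge0 => x; exact: normr_ge0.
set alpha := 4 / (rb * omega) * (rb * n%:R); set beta := 4 / (rb * omega) * _.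
have lam_le : `|lam| <= alpha * X + beta.
  rewrite -(ler_pM2r (_ : 0 < rb * (omega / 4))); last by rewrite mulr_gt0// divr_gt0.
  apply: le_trans right_le _; rewrite le_eqVlt; apply/orP; left; apply/eqP.
  by rewrite /alpha /beta; field; rewrite !gt_eqF.
have : `|lam| ^+ 2 <= (alpha * X + beta) ^+ 2.
  by rewrite ler_sqr// nnegrE//; apply: le_trans lam_le.
rewrite real_normK ?num_real// => /le_trans; apply.
have X2 : X ^+ 2 = 2 * M * D by rewrite /X sqr_sqrtr// !mulr_ge0// ltW.
rewrite -mulrA -X2 -mulrA -exprMn.
have := sqr_ge0 (alpha * X - beta); nra.
Qed.

End fixed.

(** One of the two preceding bounds applies, according to the size of the
    transition layer. *)
Lemma sqr_lambda_le (omega M : R) : 0 < omega -> 0 < M ->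
  exists A B : R, [/\ 0 <= A, 0 <= B &
  forall (eps lam : R) (u p : Rn -> R), 0 < eps < 1 -> class_C 2 setT u -> Defs.periodic u ->
    (forall x, eps * p x = eps * laplacian u x - derive1 W (u x) / eps
       + lam * Num.sqrt (2 * W (u x))) ->
    energy eps u <= M -> `|avg (fun x => k (u x))| <= 2 / 3 - omega ->
    lam ^+ 2 <= A + B * avg (fun x => eps * p x ^+ 2)].
Proof.
move=> omega0 M0.
set A1 := 8 / omega ^+ 2 * (8 * M / omega ^+ 2 + 4 * M) ^+ 2.
set B1 := 8 / omega ^+ 2.
pose rb := avg (@cutoff R n).
pose c := \sum_i avg (fun x => `|@partial_cutoff R n i x|).
pose delta := omega / (4 * (n%:R * M + 1)).
set A2 := 2 * (4 / (rb * omega) * (n%:R * (delta^-1 * (3 * M * c)))) ^+ 2.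
set B2 := 2 * (4 / (rb * omega) * (rb * n%:R)) ^+ 2 * (2 * M).
have A10 : 0 <= A1 by rewrite mulr_ge0 ?sqr_ge0// divr_ge0 ?sqr_ge0.
have B10 : 0 <= B1 by rewrite divr_ge0 ?sqr_ge0.
have A20 : 0 <= A2 by rewrite mulr_ge0 ?sqr_ge0.
have B20 : 0 <= B2 by apply: mulr_ge0; [rewrite mulr_ge0 ?sqr_ge0|rewrite mulr_ge0 ?ltW].
exists (A1 + A2), (B1 + B2); split; [exact: addr_ge0..|].
move=> eps lam u p eps01 C2u pu eq_p E_le V_le.
set D := avg _.
have D0 : 0 <= D by apply: avg_ge0 => x; rewrite mulr_ge0 ?sqr_ge0//; case/andP: eps01 => /ltW.
have B1D : 0 <= B1 * D by exact: mulr_ge0.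
have B2D : 0 <= B2 * D by exact: mulr_ge0.
have [so|os] := leP (avg (fun x => `|1 - u x ^+ 2|)) (omega / 2).
  have := sqr_lambda_le_sharp omega0 M0 eps01 C2u pu eq_p E_le V_le so.
  by rewrite -/rb -/c -/delta -/A2 -/B2 -/D; lra.
have := sqr_lambda_le_diffuse omega0 M0 eps01 C2u pu eq_p E_le (ltW os).
by rewrite -/A1 -/B1 -/D; lra.
Qed.

End static_estimate.

(** * Continuity up to the initial time *)
Section within_continuity.
Context {R : realType} {T : topologicalType}.
Implicit Types (S : set T) (F G : T -> R).

Lemma eq_within S F G : F =1 G -> {within S, continuous F} -> {within S, continuous G}.
Proof. by move=> /funext ->. Qed.

Lemma withinC S (c : R) : {within S, continuous (fun=> c)}.
Proof. by apply/subspace_continuousP => x _; exact: cvg_cst. Qed.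

Lemma withinD S F G : {within S, continuous F} -> {within S, continuous G} ->
  {within S, continuous (fun p => F p + G p)}.
Proof.
move=> /subspace_continuousP cF /subspace_continuousP cG.
by apply/subspace_continuousP => x Sx; exact: cvgD (cF x Sx) (cG x Sx).
Qed.

Lemma withinM S F G : {within S, continuous F} -> {within S, continuous G} ->
  {within S, continuous (fun p => F p * G p)}.
Proof.
move=> /subspace_continuousP cF /subspace_continuousP cG.
by apply/subspace_continuousP => x Sx; exact: cvgM (cF x Sx) (cG x Sx).
Qed.

Lemma within_comp S F (g : R -> R) : {within S, continuous F} -> continuous g ->
  {within S, continuous (fun p => g (F p))}.
Proof.
move=> /subspace_continuousP cF cg; apply/subspace_continuousP => x Sx.
exact: (continuous_cvg _ (cg (F x)) (cF x Sx)).
Qed.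

Lemma within_sum S m (F : 'I_m -> T -> R) : (forall i, {within S, continuous (F i)}) ->
  {within S, continuous (fun p => \sum_i F i p)}.
Proof.
elim: m F => [|m IH] F cF.
  by apply: (eq_within (F := fun=> 0)) => [x|]; [rewrite big_ord0|exact: withinC].
apply: (eq_within (F := fun x => F ord0 x + \sum_(i < m) F (lift ord0 i) x)) => [x|].
  by rewrite big_ord_recl.
by apply: withinD => //; exact: IH.
Qed.

End within_continuity.

Section within_time.
Context {R : realType} {n : nat}.
Local Notation Rn := 'rV[R]_n.
Variables (A : set R) (F : R * Rn -> R).
Hypothesis cF : {within [set p | A p.1], continuous F}.

Lemma within_cvg t0 x : A t0 -> forall e, 0 < e ->
  \forall x' \near x & t \near within A (nbhs t0), `|F (t, x') - F (t0, x)| < e.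
Proof.
move=> At0 e e0; have /subspace_continuousP/(_ (t0, x) At0)/cvgrPdist_lt/(_ e e0) := cF.
case=> -[P Q] /= [Pt Qx] PQ; exists (Q, [set t | A t /\ P t]) => /=.
  by split => //; rewrite /within/=; apply: filterS Pt => t Pt At.
by move=> [x' t] /= [Qx' [At Pt']]; rewrite distrC; exact: (PQ (t, x')).
Qed.

Lemma within_slice t0 : A t0 -> continuous (fun x => F (t0, x)).
Proof.
move=> At0 x V /nbhs_ballP[e /= e0 eV].
have [[P Q] /= [Px Qt] PQ] := @within_cvg t0 x At0 e e0.
suff : P `<=` [set x' | V (F (t0, x'))] by move=> /filterS; apply.
move=> x' Px'; apply: eV; rewrite /ball/= distrC; apply: (PQ (x', t0)); split => //=.
by have := nbhs_singleton Qt; exact.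
Qed.

Lemma within_joint t0 x : A t0 -> (\forall t \near t0, A t) ->
  joint_cvg (fun t x => F (t, x)) t0 x.
Proof.
move=> At0 nA e e0; have [[P Q] /= [Px Qt] PQ] := @within_cvg t0 x At0 e e0.
exists (P, [set t | A t /\ Q t]) => /=.
  split => //; have {}Qt : \forall t \near t0, A t -> Q t := Qt.
  by apply: filterS2 nA Qt => t At AQ; split => //; exact: AQ.
by move=> [x' t] /= [Px' [_ Qt']]; exact: (PQ (x', t)).
Qed.

Lemma avg_within : {within A, continuous (fun t => avg (fun x => F (t, x)))}.
Proof.
apply/subspace_continuousP => t0 At0.
have H : avg (fun x => F (t, x)) @[t --> within A (nbhs t0)] --> avg (fun x => F (t0, x)).
  apply: (@avg_cvg R n R (within A (nbhs t0)) _ (fun t x => F (t, x))).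
  - exact: within_slice.
  - by rewrite near_withinE; apply: nearW => t At; exact: (within_slice At).
  - by move=> x _ e e0; exact: within_cvg.
exact: H.
Qed.

End within_time.

(** * Evolution of the volume and of the energy *)
Section evolution.
Context {R : realType} {n : nat}.
Local Notation Rn := 'rV[R]_n.

(** Integrates the divergence of (u - v) grad (u + v). Third derivatives or mixed
    derivatives in time and space are thus avoided when the Dirichlet energy is
    differentiated in time. *)
Lemma avg_dirichlet_diff (u v : Rn -> R) : class_C 2 setT u -> class_C 2 setT v ->
  Defs.periodic u -> Defs.periodic v ->
  avg (fun x => \sum_i partial i u x ^+ 2) - avg (fun x => \sum_i partial i v x ^+ 2) =
  - avg (fun x => (u x - v x) * (laplacian u x + laplacian v x)).
Proof.
move=> /class_C2P[cu cu1 du cu2 du2] /class_C2P[cv cv1 dv cv2 dv2] pu pv.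
have cg (w : Rn -> R) : (forall i, continuous (partial i w)) ->
    continuous (fun x => \sum_i partial i w x ^+ 2).
  by move=> cw; apply: cont_sum => i _; apply: contX; exact: cw.
have cgu := cg u cu1; have cgv := cg v cv1.
have clu : continuous (laplacian u) by apply: cont_sum => i _; exact: cu2.
have clv : continuous (laplacian v) by apply: cont_sum => i _; exact: cv2.
(* The components of the vector field and their partial derivatives. *)
pose g i x := (u x - v x) * (partial i u x + partial i v x).
pose dg i x := (partial i u x - partial i v x) * (partial i u x + partial i v x)
   + (u x - v x) * (partial i (partial i u) x + partial i (partial i v) x).
have cuv : continuous (fun x => u x - v x) by exact: contD cu (contN cv).
have cgi i : continuous (g i) by exact: contM cuv (contD (cu1 i) (cv1 i)).
have cdg i : continuous (dg i).
  exact: contD (contM (contD (cu1 i) (contN (cv1 i))) (contD (cu1 i) (cv1 i)))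
    (contM cuv (contD (cu2 i i) (cv2 i i))).
have pg i : Defs.periodic (g i).
  have p1 := periodic_partial pu (du i); have p2 := periodic_partial pv (dv i).
  by move=> x z; rewrite /g pu pv p1 p2.
have gdg i : has_partial i (g i) (dg i).
  by move=> x; exact: is_derive_mul (is_derive_sub (du i x) (dv i x)) (is_derive_add (du2 i i x) (dv2 i i x)).
have z : avg (fun x => \sum_i dg i x) = 0.
  rewrite avg_sum//; apply: big1 => i _.
  exact: avg_partial0 (@cgi i) (@cdg i) (@pg i) (@gdg i).
have cl : continuous (fun x => (u x - v x) * (laplacian u x + laplacian v x)).
  exact: contM cuv (contD clu clv).
rewrite -avgB//; apply/eqP; rewrite -addr_eq0 -avgD//; last exact: contD cgu (contN cgv).
rewrite -[X in _ == X]z; apply/eqP/eq_avg => x _.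
rewrite /dg big_split/= -mulr_sumr big_split/= -sumrB; congr (_ + _).
by apply: eq_bigr => i _; rewrite subr_sqr.
Qed.

Variables (eps : R) (u0 : Rn -> R) (phi : R -> Rn -> R).
Hypotheses (eps01 : 0 < eps < 1) (sol : solution eps u0 phi).

Let eps0 : 0 < eps. Proof. by case/andP: eps01. Qed.

Let dphi (t : R) x := derive1 (phi ^~ x) t.
Definition dissipation (t : R) : R := avg (fun x => eps * derive1 (phi ^~ x) t ^+ 2).
Definition volume (t : R) : R := avg (fun x => k (phi t x)).

Let P0 : set (R * Rn) := [set p | 0 <= p.1].
Let Pp : set (R * Rn) := [set p | 0 < p.1].

Let C2 (t : R) : 0 <= t -> class_C 2 setT (phi t). Proof. exact: (solution_C2 sol). Qed.
Let per (t : R) : 0 <= t -> Defs.periodic (phi t). Proof. exact: (solution_periodic sol). Qed.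
Let cphi : {within P0, continuous (fun p => phi p.1 p.2)}.
Proof. exact: (solution_continuous sol). Qed.
Let cphi1 i : {within P0, continuous (fun p => partial i (phi p.1) p.2)}.
Proof. exact: (solution_partial_continuous sol). Qed.
Let clap : {within P0, continuous (fun p => laplacian (phi p.1) p.2)}.
Proof. by apply: within_sum => i; exact: (solution_partial2_continuous sol). Qed.
Let cdphi : {within Pp, continuous (fun p => dphi p.1 p.2)}.
Proof. exact: (solution_dt_continuous sol). Qed.
Let ddphi (t : R) (x : Rn) : 0 < t -> is_derive t (1 : R) (fun s => phi s x) (dphi t x).
Proof.
by move=> t0; split; [exact: (solution_derivable sol)|rewrite -derive1E].
Qed.

Let sub_Pp : Pp `<=` P0. Proof. by move=> p /ltW. Qed.

Let near_pos (t : R) : 0 < t -> \forall s \near t, 0 < s.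
Proof. by move=> t0; exact: lt_nbhsr. Qed.

Let near_pos_lt (t s : R) : 0 < t -> `|s - t| < t -> 0 < s.
Proof. by move=> t0; rewrite ltr_norml => /andP[]; lra. Qed.

Let slice_phi (t : R) : 0 <= t -> continuous (phi t).
Proof. by move=> t0; have := within_slice (A := [set t | 0 <= t]) cphi t0. Qed.

Let slice_lap (t : R) : 0 <= t -> continuous (laplacian (phi t)).
Proof. by move=> t0; have := within_slice (A := [set t | 0 <= t]) clap t0. Qed.

Let slice_dphi (t : R) : 0 < t -> continuous (dphi t).
Proof. by move=> t0; have := within_slice (A := [set t | 0 < t]) cdphi t0. Qed.

Lemma within_energy : {within [set t | 0 <= t], continuous (fun t => energy eps (phi t))}.
Proof.
apply: (avg_within (F := fun p : R * Rn => energy_density eps (phi p.1) p.2)).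
apply: (eq_within (F := fun p : R * Rn => eps / 2 * (\sum_i partial i (phi p.1) p.2 * partial i (phi p.1) p.2) + W (phi p.1 p.2) * eps^-1)).
  by move=> p; rewrite energy_densityE; congr (_ * _ + _).
apply: withinD; apply: withinM; try exact: withinC.
  by apply: within_sum => i; apply: withinM; exact: cphi1.
exact: (within_comp cphi (@cont_W R)).
Qed.

Lemma within_volume : {within [set t | 0 <= t], continuous volume}.
Proof.
apply: (avg_within (F := fun p : R * Rn => k (phi p.1 p.2))).
exact: (within_comp cphi (@cont_k R)).
Qed.

Lemma within_dissipation : {within [set t | 0 < t], continuous dissipation}.
Proof.
apply: (avg_within (F := fun p : R * Rn => eps * dphi p.1 p.2 ^+ 2)).
apply: withinM; first exact: withinC.
exact: (withinM cdphi cdphi).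
Qed.

Let is_derive_avg_comp (K dK : R -> R) (t : R) : continuous K -> continuous dK ->
  (forall s : R, is_derive s (1 : R) K (dK s)) -> 0 < t ->
  is_derive t (1 : R) (fun t => avg (fun x => K (phi t x)))
    (avg (fun x => dK (phi t x) * dphi t x)).
Proof.
move=> cK cdK dKK t0.
apply: (@is_derive_avg R n (fun t x => K (phi t x)) (fun t x => dK (phi t x) * dphi t x) t t) => //.
- move=> s /(near_pos_lt t0)/ltW s0; exact: (cont_comp (slice_phi s0) cK).
- exact: contM (cont_comp (slice_phi (ltW t0)) cdK) (slice_dphi t0).
- move=> s x /(near_pos_lt t0) s0; exact: (@is_derive_compose _ _ K (fun s => phi s x) s 1 _ _ (dKK _) (ddphi x s0)).
- move=> x _.
  have c : {within Pp, continuous (fun p => dK (phi p.1 p.2) * dphi p.1 p.2)}.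
    by apply: withinM cdphi; apply: continuous_subspaceW sub_Pp _; exact: within_comp.
  have J := within_joint (A := [set t | 0 < t]) c x t0 (near_pos t0); exact: J.
Qed.

Let cmod (t : R) : 0 <= t -> continuous (fun x => `|1 - phi t x ^+ 2|).
Proof. by move=> t0; have cp := slice_phi t0; cont. Qed.

(** The multiplier is defined so that this average vanishes. If the potential is
    identically 0 its defining quotient is meaningless, but then the integrand is
    0 as well. *)
Lemma avg_mod_dphi (t : R) : 0 < t -> avg (fun x => `|1 - phi t x ^+ 2| * dphi t x) = 0.
Proof.
move=> t0; have t0' := ltW t0.
have cp := slice_phi t0'; have cd := slice_dphi t0; have cl := slice_lap t0'; have cm := cmod t0'.
have cWp : continuous (fun x => W (phi t x)) by exact: (cont_comp cp (@cont_W R)).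
have cW' : continuous (fun x => derive1 W (phi t x)).
  by apply: (eq_cont (fun x => esym (derive1_W (phi t x)))); cont.
(* If the potential vanishes identically, so does the weight. *)
have [W0|W0] := eqVneq (avg (fun x => W (phi t x))) 0.
  apply/eqP; rewrite -sqrf_eq0 eq_le sqr_ge0 andbT.
  apply: le_trans (avg_cauchy_schwarz cm cd) _.
  have -> : avg (fun x => `|1 - phi t x ^+ 2| ^+ 2) = 0.
    rewrite -[RHS](mulr0 2) -W0 -avgZ//; apply: eq_avg => x _.
    by rewrite real_normK ?num_real// /W mulrC divfK// pnatr_eq0.
  by rewrite mul0r.
apply: (mulfI (lt0r_neq0 eps0)); rewrite mulr0 -avgZ; last by cont.
pose N x := Num.sqrt (2 * W (phi t x)) * (eps * laplacian (phi t) x - derive1 W (phi t x) / eps).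
have cN : continuous N.
  have c1 : continuous (fun x => Num.sqrt (2 * W (phi t x))) by exact: (cont_comp cp (@cont_sqrt_2W R)).
  by apply: contM => //; cont.
transitivity (avg (fun x => N x + lambda eps (phi t) * 2 * W (phi t x))).
  apply: eq_avg => x _; rewrite mulrCA (solution_equation sol x t0) mulrDr /N sqrt_2W; congr (_ + _).
  rewrite /W -(real_normK (num_real (1 - _))) expr2.
  by field.
rewrite avgD//; last by cont.
rewrite avgZ// /lambda -/(avg _) -/(avg _) -/N -mulrA divfK ?subrr//.
by rewrite mulf_neq0// pnatr_eq0.
Qed.

Lemma is_derive_volume (t : R) : 0 < t -> is_derive t (1 : R) volume 0.
Proof.
move=> t0; rewrite -(avg_mod_dphi t0).
apply: (@is_derive_avg_comp (@k R) (fun s => `|1 - s ^+ 2|)) => //.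
- exact: cont_k.
- by cont.
- exact: is_derive_k.
Qed.

(** Gradient-flow identity: the first variation tested with the time derivative
    is minus the dissipation plus the multiplier times the variation of the
    volume, which is 0. *)
Lemma is_derive_energy (t : R) : 0 < t ->
  is_derive t (1 : R) (fun s => energy eps (phi s)) (- dissipation t).
Proof.
move=> t0; have t0' := ltW t0.
have cp := slice_phi t0'; have cd := slice_dphi t0; have cl := slice_lap t0'; have cm := cmod t0'.
have cWs s : 0 <= s -> continuous (fun x => W (phi s x)).
  by move=> s0; exact: (cont_comp (slice_phi s0) (@cont_W R)).
have cW' : continuous (fun x => derive1 W (phi t x)).
  by apply: (eq_cont (fun x => esym (derive1_W (phi t x)))); cont.
have dWp : is_derive t (1 : R) (fun t => avg (fun x => W (phi t x)))
    (avg (fun x => derive1 W (phi t x) * dphi t x)).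
  apply: (@is_derive_avg_comp (@W R) (derive1 W)) => //; first exact: cont_W.
    by apply: (eq_cont (fun x => esym (derive1_W x))); cont.
  by move=> s; rewrite derive1_W; exact: is_derive_W.
have dG : is_derive t (1 : R)
    (fun s => avg (fun x => (phi s x - phi t x) * (laplacian (phi s) x + laplacian (phi t) x)))
    (avg (fun x => dphi t x * (laplacian (phi t) x + laplacian (phi t) x))).
  apply: (@is_derive_avg_mul R n phi dphi (fun s x => laplacian (phi s) x + laplacian (phi t) x) t t) => //.
  - by move=> s /(near_pos_lt t0)/ltW; exact: slice_phi.
  - by move=> s /(near_pos_lt t0)/ltW s0; exact: contD (slice_lap s0) cl.
  - by move=> s x /(near_pos_lt t0) s0; exact: ddphi.
  - by move=> x _; have J := within_joint (A := [set t | 0 < t]) cdphi x t0 (near_pos t0); exact: J.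
  - move=> x _; have near0 : \forall s \near t, 0 <= s by apply: filterS (near_pos t0) => s /ltW.
    have c : {within P0, continuous (fun p => laplacian (phi p.1) p.2 + laplacian (phi t) p.2)}.
      apply: withinD clap _; apply: continuous_subspaceT.
      exact: (cont_comp (@cont_snd R Rn) cl).
    have J := within_joint (A := [set t | 0 <= t]) c x t0' near0; exact: J.
have dE := is_derive_add (is_derive_add (is_derive_scale (- (eps / 2)) dG)
  (is_derive_scale eps^-1 (is_derive_sub dWp (is_derive_const t (1 : R) (avg (fun x => W (phi t x)))))))
  (is_derive_const t (1 : R) (energy eps (phi t))).
have cE s : 0 <= s -> continuous (fun x => \sum_i partial i (phi s) x ^+ 2).
  by move=> /C2/class_C2P[_ c1 _ _ _]; apply: cont_sum => i _; apply: contX; exact: c1.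
have EE s : 0 <= s -> energy eps (phi s) =
    eps / 2 * avg (fun x => \sum_i partial i (phi s) x ^+ 2) + eps^-1 * avg (fun x => W (phi s x)).
  move=> s0; have c1 := cE s s0; have c2 := cWs s s0.
  rewrite -avgZ// -avgZ// -avgD; [|by cont..].
  by apply: eq_avg => x _; rewrite energy_densityE (mulrC (W _)).
have val : - (eps / 2) * avg (fun x => dphi t x * (laplacian (phi t) x + laplacian (phi t) x))
   + eps^-1 * (avg (fun x => derive1 W (phi t x) * dphi t x) - 0) + 0 = - dissipation t.
  have cN : continuous (fun x => `|1 - phi t x ^+ 2| * dphi t x) by exact: contM.
  rewrite subr0 addr0 -[RHS]addr0 -(mulr0 (lambda eps (phi t))) -(avg_mod_dphi t0).
  have c1 : continuous (fun x => dphi t x * (laplacian (phi t) x + laplacian (phi t) x)).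
    exact: contM cd (contD cl cl).
  have c2 : continuous (fun x => derive1 W (phi t x) * dphi t x) by exact: contM.
  have c3 : continuous (fun x => eps * dphi t x ^+ 2) by exact: contM (@cont_cst _ _ eps) (contX cd).
  rewrite -(avgZ _ c1) -(avgZ _ c2) -(avgZ _ cN) /dissipation -(avgN c3).
  rewrite -(avgD (contM (@cont_cst _ _ _) c1) (contM (@cont_cst _ _ _) c2)).
  rewrite -(avgD (contN c3) (contM (@cont_cst _ _ _) cN)).
  apply: eq_avg => x _; rewrite -/(dphi t x).
  have := solution_equation sol x t0; rewrite sqrt_2W -/(dphi t x) => eq1.
  have -> : - (eps * dphi t x ^+ 2) = - (eps * dphi t x) * dphi t x by ring.
  by rewrite eq1; field; rewrite gt_eqF.
rewrite val in dE; apply: near_eq_is_derive dE.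
apply: filterS (near_pos t0) => s s0; rewrite (EE s (ltW s0)) (EE t t0').
have := avg_dirichlet_diff (C2 (ltW s0)) (C2 t0') (per (ltW s0)) (per t0').
set a := avg _; set b := avg _; set c := avg (fun x => _ * _) => abc.
have -> : c = b - a by rewrite -[c]opprK -abc opprB.
by ring.
Qed.

Lemma volume_const (t : R) : 0 < t -> volume t = volume 0.
Proof.
move=> t0.
have sub : `[0%R, t]%classic `<=` [set s | 0 <= s] by move=> s /=; rewrite in_itv/= => /andP[].
have [|c _] := MVT t0 (f := volume) (df := fun=> 0) _ (continuous_subspaceW sub within_volume).
  by move=> s; rewrite in_itv/= => /andP[s0 _]; exact: is_derive_volume.
by rewrite mul0r => /eqP; rewrite subr_eq0 => /eqP.
Qed.

Let dissipation_ge0 (t : R) : 0 <= dissipation t.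
Proof. by apply: avg_ge0 => x; rewrite mulr_ge0 ?sqr_ge0// ltW. Qed.

Lemma energy_nonincreasing (t : R) : 0 < t -> energy eps (phi t) <= energy eps (phi 0).
Proof.
move=> t0.
have sub : `[0%R, t]%classic `<=` [set s | 0 <= s] by move=> s /=; rewrite in_itv/= => /andP[].
have [|c _ E] := MVT t0 (f := fun s => energy eps (phi s)) (df := fun s => - dissipation s)
   _ (continuous_subspaceW sub within_energy).
  by move=> s; rewrite in_itv/= => /andP[s0 _]; exact: is_derive_energy.
rewrite -subr_le0 E subr0 mulNr oppr_le0 mulr_ge0// ltW//.
Qed.

Lemma energy_nonneg (t : R) : 0 <= t -> 0 <= energy eps (phi t).
Proof. by move=> t0; apply: avg_ge0 => x; exact: energy_density_ge0. Qed.

(** The integrand is the derivative of A t - B E(t), where E is the energy. The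
    time 0 is excluded because the time derivative is only continuous for
    positive times. *)
Lemma integral_dissipation_le (A B tau T : R) : 0 <= B -> 0 < tau -> tau < T -> 0 <= A ->
  (\int[lebesgue_measure]_(t in `[tau, T]) (A + B * dissipation t)%:E <=
   (A * T + B * energy eps (phi 0))%:E)%E.
Proof.
move=> B0 tau0 tauT A0; have T0 := lt_trans tau0 tauT.
pose F t := A * t - B * energy eps (phi t).
have dF (t : R) : 0 < t -> is_derive t (1 : R) F (A + B * dissipation t).
  move=> t0; have := is_derive_sub (is_derive_scale A (@is_derive_idfun R t)) (is_derive_scale B (is_derive_energy t0)).
  by rewrite mulr1 mulrN opprK.
have cF (t : R) : 0 < t -> {for t, continuous F}.
  by move=> t0; apply/differentiable_continuous/derivable1_diffP; case: (dF t t0).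
have sub : `[tau, T]%classic `<=` [set s | 0 < s].
  by move=> s /=; rewrite in_itv/= => /andP[h _]; exact: lt_le_trans h.
rewrite (continuous_FTC2 tauT (F := F)).
- rewrite -EFinB lee_fin /F opprB addrACA [leRHS]addrC.
  have e1 := energy_nonincreasing tau0; have e2 := energy_nonneg (ltW T0).
  have : B * energy eps (phi tau) <= B * energy eps (phi 0) by rewrite ler_wpM2l.
  have : 0 <= B * energy eps (phi T) by rewrite mulr_ge0.
  have : 0 <= A * tau by rewrite mulr_ge0// ltW.
  by lra.
- apply: withinD; first exact: withinC.
  by apply: withinM; [exact: withinC|exact: continuous_subspaceW sub within_dissipation].
- split.
  + by move=> t; rewrite in_itv/= => /andP[h _]; case: (dF t (lt_trans tau0 h)).
  + by apply: cvg_at_right_filter; exact: cF.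
  + by apply: cvg_at_left_filter; exact: cF.
- move=> t; rewrite in_itv/= => /andP[h _]; rewrite derive1E.
  by case: (dF t (lt_trans tau0 h)).
Qed.

End evolution.

(** * Integration in time *)
(** The integral of a nonnegative function is a supremum over simple functions
    below it, hence monotone without any measurability; this avoids proving that
    the multiplier is a measurable function of time. *)
Lemma ge0_le_integral_dominated d (T : measurableType d) (R : realType)
    (mu : {measure set T -> \bar R}) (D : set T) (f g : T -> \bar R) :
  (forall x, D x -> (0 <= f x <= g x)%E) ->
  (\int[mu]_(x in D) f x <= \int[mu]_(x in D) g x)%E.
Proof.
move=> fg; have f0 x : D x -> (0 <= f x)%E by move=> /fg/andP[].
have g0 x : D x -> (0 <= g x)%E by move=> /fg/andP[]; exact: le_trans.
rewrite (ge0_integralE mu f0) (ge0_integralE mu g0).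
apply: ereal_sup_le => _ [h hf <-]; exists h => // x.
apply: le_trans (hf x) _; rewrite /patch; case: ifPn => // xD.
by have /andP[] := fg x (set_mem xD).
Qed.

Section conclusion.
Context {R : realType} {n : nat}.
Local Notation Rn := 'rV[R]_n.

Lemma energy_le_energy_measure (eps D1 : R) (u : Rn -> R) : class_C 2 setT u ->
  (energy_measure eps u cube <= D1%:E)%E -> energy eps u <= 4 / 3 * D1.
Proof.
move=> /(cont_energy_density (eps := eps)) cu.
have fi : (\int[lebesgueRn n]_(x in cube) (energy_density eps u x)%:E)%E \is a fin_num.
  by apply: integrable_fin_num (cont_integrable cu); exact: measurable_cube.
rewrite /energy_measure -[X in (_ * X)%E](fineK fi) -EFinM lee_fin sigmaE.
rewrite -/(energy eps u) => h; rewrite mulrC -ler_pdivrMr ?divr_gt0//.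
by rewrite mulrC.
Qed.

Variables (eps : R) (u0 : Rn -> R) (phi : R -> Rn -> R) (A B T : R).
Hypotheses (eps01 : 0 < eps < 1) (sol : solution eps u0 phi).
Hypotheses (A0 : 0 <= A) (B0 : 0 <= B) (T0 : 0 < T).
Hypothesis lambda_le : forall t, 0 < t ->
  (lambda eps (phi t)) ^+ 2 <= A + B * dissipation eps phi t.

(** The pointwise bound is integrated on [T / (i + 2), T] and i tends to infinity;
    the value at time 0 does not contribute to the integral. *)
Lemma integral_sqr_lambda_le :
  (\int[lebesgue_measure]_(t in `[0%R, T]) ((lambda eps (phi t)) ^+ 2)%:E <=
   (A * T + B * energy eps (phi 0))%:E)%E.
Proof.
set C := (A * T + _).
pose f t := A + B * dissipation eps phi t.
have f0 t : 0 <= f t.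
  rewrite addr_ge0// mulr_ge0//; apply: avg_ge0 => x.
  by rewrite mulr_ge0 ?sqr_ge0//; case/andP: eps01 => /ltW.
(* The bound on the multiplier says nothing at time 0, where the solution need
   not be differentiable in time. *)
pose h t := if t == 0 then (lambda eps (phi 0)) ^+ 2 else f t.
apply: (@le_trans _ _ (\int[lebesgue_measure]_(t in `[0%R, T]) (h t)%:E)%E).
  apply: ge0_le_integral_dominated => t /=; rewrite in_itv/= => /andP[t0 _].
  rewrite !lee_fin sqr_ge0/= /h; case: eqVneq => [->//|tn0].
  by apply: lambda_le; rewrite lt_neqAle eq_sym tn0.
have cf : {within [set t | 0 < t], continuous f}.
  apply: withinD; first exact: withinC.
  by apply: withinM; [exact: withinC|exact: (within_dissipation sol)].
have mf : measurable_fun (`]0%R, T] : set R) f.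
  apply: subspace_continuous_measurable_fun => //.
  by apply: continuous_subspaceW cf => t /=; rewrite in_itv/= => /andP[].
have fh t : (`]0%R, T]%classic : set R) t -> h t = f t.
  by rewrite /= in_itv/= /h => /andP[t0 _]; rewrite gt_eqF.
have mh : measurable_fun (`]0%R, T] : set R) (fun t => (h t)%:E).
  apply/measurable_EFinP; apply: eq_measurable_fun mf => t; rewrite inE => tI.
  by rewrite fh.
rewrite -integral_itv_obnd_cbnd//.
have -> : (\int[lebesgue_measure]_(t in `]0%R, T]) (h t)%:E =
           \int[lebesgue_measure]_(t in `]0%R, T]) (f t)%:E)%E.
  by apply: eq_integral => t; rewrite inE => tI; rewrite fh.
pose F i := [set` `[T / i.+2%:R, T]%R] : set R.
have Fsub i : F i `<=` `]0%R, T]%classic.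
  move=> t; rewrite /F/= !in_itv/= => /andP[h1 ->]; rewrite andbT.
  by apply: lt_le_trans h1; rewrite divr_gt0// ltr0n.
have FU : \bigcup_i F i = `]0%R, T]%classic.
  apply/seteqP; split => [t [i _]|t /=]; first exact: Fsub.
  rewrite in_itv/= => /andP[t0 tT].
  exists (Num.truncn (T / t)) => //; rewrite /F/= in_itv/= tT andbT.
  rewrite ler_pdivrMr ?ltr0n// mulrC -ler_pdivrMr//; apply/ltW.
  apply: lt_trans (truncnS_gt (T / t)) _; by rewrite ltr_nat.
have cv : (\int[@lebesgue_measure R]_(t in F i) (f t)%:E @[i --> \oo] -->
           \int[@lebesgue_measure R]_(t in \bigcup_i F i) (f t)%:E)%E.
  apply: ge0_nondecreasing_set_cvg_integral.
  - apply/nondecreasing_seqP => i; rewrite subsetEset => t; rewrite /F/= !in_itv/= => /andP[h1 ->].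
    rewrite andbT; apply: le_trans h1; rewrite ler_pM2l// lef_pV2 ?posrE ?ltr0n//.
    by rewrite ler_nat.
  - by move=> i; exact: measurable_itv.
  - by move=> i; apply/measurable_EFinP; apply: measurable_funS mf => //; exact: Fsub.
  - by move=> i t _; rewrite lee_fin.
rewrite -FU -(cvg_lim (@ereal_hausdorff R) cv).
apply: lime_le; first by apply/cvg_ex; exists (\int[@lebesgue_measure R]_(t in \bigcup_i F i) (f t)%:E)%E.
apply: nearW => i; apply: (integral_dissipation_le eps01 sol) => //.
  by rewrite divr_gt0// ltr0n.
by rewrite ltr_pdivrMr ?ltr0n// ltr_pMr// ltr1n.
Qed.

End conclusion.

Theorem proposition3p3 (R : realType) (d : nat) (d_ge2 : (2 <= d)%N)
    (omega : R) (omega_gt0 : 0 < omega) :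
  exists2 eps1 : R, 0 < eps1 &
  forall D1 : R, 0 < D1 ->
  exists2 c1 : R, 0 < c1 &
  forall (U0 : set 'rV[R]_d) (U : (set 'rV[R]_d)^nat) (eps : R^nat)
      (rbar : nat -> 'rV[R]_d -> R) (phi : nat -> R -> 'rV[R]_d -> R),
    initial_set U0 U ->
    (forall i, 0 < eps i < 1) ->
    nonincreasing_seq eps ->
    eps i @[i --> \oo] --> (0 : R) ->
    (forall i, smoothed_signed_dist (eps i) (periodic_extension (U i))
                 (periodic_extension (boundary (U i))) (rbar i)) ->
    (forall i, initial_bounds omega D1 (eps i)
                 (fun x => q (eps i) (rbar i x))) ->
    (forall i, solution (eps i) (fun x => q (eps i) (rbar i x)) (phi i)) ->
    forall T : R, 0 < T ->
    (ereal_sup [set \int[lebesgue_measure]_(t in `[0%R, T])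
                      ((lambda (eps i) (phi i t)) ^+ 2)%:E |
                i in [set i | (0 < eps i < eps1)%R]]
     <= (c1 * (1 + T))%:E)%E.
Proof.
(* The bound holds for all eps < 1, so any threshold will do; M bounds the
   energy because sigma = 4 / 3. *)
exists 1 => // D1 D10; pose M := 4 / 3 * D1.
have M0 : 0 < M by rewrite mulr_gt0// divr_gt0.
have [A [B [A0 B0 AB]]] := @sqr_lambda_le R d omega M omega_gt0 M0.
have BM0 : 0 <= B * M by rewrite mulr_ge0// ltW.
exists (A + B * M + 1); first by rewrite ltr_wpDl// addr_ge0.
move=> U0 U eps rbar phi _ eps01 _ _ _ ini sol T T0.
apply/ereal_supP => _ [i _ <-].
have s := sol i; have phi0 := solution_initial s; have e01 := eps01 i.
have E0 : energy (eps i) (phi i 0) <= M.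
  apply: energy_le_energy_measure; first exact: (solution_C2 s).
  by rewrite phi0; exact: bound_energy (ini i).
have lam t : 0 < t -> (lambda (eps i) (phi i t)) ^+ 2 <= A + B * dissipation (eps i) (phi i) t.
  move=> t0; apply: (AB (eps i) _ (phi i t) (fun x => derive1 (phi i ^~ x) t)) => //.
  - exact: (solution_C2 s (ltW t0)).
  - exact: (solution_periodic s (ltW t0)).
  - by move=> x; exact: (solution_equation s x t0).
  - exact: le_trans (energy_nonincreasing e01 s t0) E0.
  - have := volume_const e01 s t0; rewrite /volume => ->.
    by rewrite phi0; exact: bound_volume (ini i).
apply: le_trans (integral_sqr_lambda_le e01 s A0 B0 T0 lam) _.
rewrite lee_fin; have : B * energy (eps i) (phi i 0) <= B * M by rewrite ler_wpM2l.
have : 0 <= B * M * T by rewrite mulr_ge0// ltW.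
by lra.
Qed.
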